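(* Let $s\in(0,1)$ and let $\Omega$ be a bounded open subset of $\mathbb{R}^n$ such that $P_s(\Omega)<\infty$. Let $\alpha,\beta:\mathcal{C}\Omega\to[0,\infty)$ be measurable and satisfy $\alpha(x)+\beta(x)>0$ for all $x\in\mathcal{C}\Omega$. For $\varepsilon>0$ and measurable $E\subset\Omega$, let $\phi_E^\varepsilon$ be the solution of $$\begin{cases}\phi+\varepsilon^s(-\Delta)^{s/2}\phi=\chi_E&\text{in }\Omega,\\ \alpha\phi+\beta\widetilde{\mathcal N}(\phi)=0&\text{in }\mathcal{C}\Omega,\end{cases}$$ and let $\mathscr{J}^s_\varepsilon(E)=\varepsilon^{-s}\int_\Omega\chi_E(1-\phi_E^\varepsilon)\,dx$. Define $$\mathscr{J}^s_0(E)=c_{n,s}\left[P_s^L(E,\Omega)+\int_{\mathcal{C}\Omega}\frac{\alpha}{\alpha+\beta}\psi_E(x)\,dx+\int_{\mathcal{C}\Omega}\frac{\beta}{\alpha+\beta}\,\frac{\psi_{E\cap\Omega}(x)\,\psi_{\mathcal{C}E\cap\Omega}(x)}{\psi_\Omega(x)}\,dx\right].$$ (i) For every set $E\subset\Omega$ such that $P_s^L(E,\Omega)<\infty$, $$\lim_{\varepsilon\to0}\mathscr{J}^s_\varepsilon(E)=\mathscr{J}^s_0(E).$$ (ii) For any family $\{E_\varepsilon\}_{\varepsilon>0}$ of subsets of $\Omega$ that converges to $E$ in $L^1(\Omega)$, $$\liminf_{\varepsilon\to0}\mathscr{J}^s_\varepsilon(E_\varepsilon)\ge\mathscr{J}^s_0(E).$$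 In particular, $\mathscr{J}^s_\varepsilon$ $\Gamma$-converges to $\mathscr{J}^s_0$ as $\varepsilon\to0$.
   Context: $\mathcal{C}F=\mathbb{R}^n\setminus F$; $\chi_E$ is the characteristic function of $E$; convergence of sets in $L^1(\Omega)$ means convergence of characteristic functions. For a set $F$, $\psi_F(x)=\int_F\frac{dy}{|x-y|^{n+s}}$ for $x\in\mathcal{C}F$. Further, $$(-\Delta)^{s/2}u(x)=c_{n,s}\,\mathrm{P.V.}\int_{\mathbb{R}^n}\frac{u(x)-u(y)}{|x-y|^{n+s}}\,dy,\qquad c_{n,s}=\frac{2^s\Gamma\left(\frac{n+s}{2}\right)}{\pi^{n/2}|\Gamma(-\frac s2)|},$$ $$P_s(\Omega)=\frac12\int_{\mathbb{R}^n}\int_{\mathbb{R}^n}\frac{|\chi_\Omega(x)-\chi_\Omega(y)|}{|x-y|^{n+s}}\,dx\,dy,\qquad P_s^L(E,\Omega)=\frac12\int_\Omega\int_\Omega\frac{|\chi_E(x)-\chi_E(y)|}{|x-y|^{n+s}}\,dx\,dy,$$ and for $x\in\mathcal{C}\Omega$ $$\mathcal N(\phi)(x)=c_{n,s}\int_\Omega\frac{\phi(x)-\phi(y)}{|x-y|^{n+s}}\,dy,\qquad \widetilde{\mathcal N}(\phi)(x)=\frac{1}{c_{n,s}\psi_\Omega(x)}\mathcal N(\phi)(x).$$ Solutions are understood in the usual variational sense: let $W$ be the space of measurable $v:\mathbb{R}^n\to\mathbb{R}$ with $v=0$ a.e. on $\{x\in\mathcal{C}\Omega:\beta(x)=0\}$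 and $\int_\Omega v^2\,dx+\iint_{\mathbb{R}^{2n}\setminus(\mathcal{C}\Omega)^2}\frac{|v(x)-v(y)|^2}{|x-y|^{n+s}}\,dx\,dy+\int_{\mathcal{C}\Omega\cap\{\beta>0\}}\psi_\Omega\frac{\alpha}{\beta}v^2\,dx<\infty$; then $\phi\in W$ and, for all $v\in W$, $$\int_\Omega\phi v\,dx+\varepsilon^sc_{n,s}\left[\frac12\iint_{\mathbb{R}^{2n}\setminus(\mathcal{C}\Omega)^2}\frac{(\phi(x)-\phi(y))(v(x)-v(y))}{|x-y|^{n+s}}\,dx\,dy+\int_{\mathcal{C}\Omega\cap\{\beta>0\}}\psi_\Omega\frac{\alpha}{\beta}\phi v\,dx\right]=\int_\Omega\chi_Ev\,dx .$$ $\Gamma$-convergence of $\mathscr{J}_\varepsilon$ to $\mathscr{J}_0$ (with respect to $L^1(\Omega)$ convergence of subsets of $\Omega$) means: for every family $E_\varepsilon\to E$, $\liminf_{\varepsilon\to0}\mathscr{J}_\varepsilon(E_\varepsilon)\ge\mathscr{J}_0(E)$; and for every $E$ there is a family $E_\varepsilon\to E$ with $\limsup_{\varepsilon\to0}\mathscr{J}_\varepsilon(E_\varepsilon)\le\mathscr{J}_0(E)$. *)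

(* Defs.v *)
From HB Require Import structures.
From mathcomp Require Import all_boot all_order all_algebra.
From mathcomp Require Import all_classical all_reals all_analysis.
Set Implicit Arguments.
Unset Strict Implicit.
Unset Printing Implicit Defensive.
Import Order.TTheory GRing.Theory Num.Theory.
Import numFieldNormedType.Exports.
Local Open Scope classical_set_scope.
Local Open Scope ring_scope.

(* Lebesgue measure on R^n = 'rV[R]_n: outer measure by countable covers with
   half-open boxes, restricted to its Caratheodory sigma-algebra, so that
   "measurable" below means Lebesgue measurable (not just Borel). *)
Section lebesgue_outer_measure.
Context {R : realType} {n : nat}.
Implicit Types (A B : set 'rV[R]_n) (b : option ('rV[R]_n * 'rV[R]_n)).
Local Open Scope ereal_scope.

(* [None] is an empty box: for n = 0 no pair of corners yields one. *)
Definition box b : set 'rV[R]_n :=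
  if b is Some (l, u) then
    [set x | forall i, (l ord0 i < x ord0 i <= u ord0 i)%R]
  else set0.

Definition box_volume b : \bar R :=
  if b is Some (l, u) then
    (\prod_(i < n) Num.max 0 (u ord0 i - l ord0 i))%R%:E
  else 0.

Definition box_cover A :=
  [set bs : nat -> option ('rV[R]_n * 'rV[R]_n) |
    A `<=` \bigcup_k box (bs k)].

Definition lebesgue_outer A : \bar R :=
  ereal_inf [set \sum_(k <oo) box_volume (bs k) | bs in box_cover A].

Lemma box_volume_ge0 b : 0 <= box_volume b.
Proof.
case: b => [[l u]|] //=; rewrite lee_fin; apply: prodr_ge0 => i _.
by rewrite le_max lexx.
Qed.

Lemma le_lebesgue_outer : {homo lebesgue_outer : A B / A `<=` B >-> A <= B}.
Proof.
move=> A B AB; apply/ereal_inf_le_tmp => x [bs Bb] <-.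
by exists bs => //; exact: subset_trans AB Bb.
Qed.

Lemma lebesgue_outer_ge0 A : 0 <= lebesgue_outer A.
Proof.
apply: le_ereal_inf_tmp => x [bs _ <-].
by apply: nneseries_ge0 => k _ _; exact: box_volume_ge0.
Qed.

Lemma lebesgue_outer0 : lebesgue_outer set0 = 0.
Proof.
apply/eqP; rewrite eq_le lebesgue_outer_ge0 andbT.
apply: ereal_inf_lbound; exists (fun=> None) => //=.
by rewrite eseries0.
Qed.

Lemma lebesgue_outer_sigma_subadditive : sigma_subadditive lebesgue_outer.
Proof.
move=> A; have [[i ioo]|] := pselect (exists i, lebesgue_outer (A i) = +oo).
  rewrite (eseries_pinfty _ _ ioo) ?leey// => k _.
  by rewrite -ltNye (lt_le_trans _ (lebesgue_outer_ge0 _)).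
rewrite -forallNE => Aoo.
suff add2e (e : {posnum R}) : lebesgue_outer (\bigcup_k A k) <=
    \sum_(i <oo) lebesgue_outer (A i) + e%:num%:E.
  by apply/lee_addgt0Pr => _/posnumP[].
rewrite (le_trans _ (epsilon_trick _ _ _))//; last first.
  by move=> k; exact: lebesgue_outer_ge0.
pose P k (bs : nat -> option _) := box_cover (A k) bs /\
  \sum_(j <oo) box_volume (bs j) <= lebesgue_outer (A k) + (e%:num / (2 ^ k.+1)%:R)%:E.
have [G PG] : {G & forall k, P k (G k)}.
  apply: (@choice _ _ P) => k; rewrite /P /lebesgue_outer.
  set S := (X in ereal_inf X); move infS : (ereal_inf S) => iS.
  case: iS infS => [r Sr|Soo|Soo].
  - have en1 : (0 < e%:num / (2 ^ k.+1)%:R)%R by [].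
    have /(lb_ereal_inf_adherent en1) : ereal_inf S \is a fin_num by rewrite Sr.
    move=> [x [bs Ab bx] xS].
    by exists bs; split => //; rewrite bx -Sr; exact/ltW.
  - by have := Aoo k; rewrite /lebesgue_outer Soo.
  - suff : lbound S 0 by move/le_ereal_inf_tmp; rewrite Soo.
    move=> /= _ [bs _ <-]; apply: nneseries_ge0 => j _ _.
    exact: box_volume_ge0.
have vG_ge0 x : 0 <= (box_volume \o uncurry G) x by exact: box_volume_ge0.
apply: (@le_trans _ _ (\esum_(i in setT) (box_volume \o uncurry G) i)).
  apply: ereal_inf_lbound => /=.
  have /card_esym/ppcard_eqP[f] := card_nat2.
  exists (uncurry G \o f).
    move=> t [i _] /(PG i).1[j _ Gijt]; exists (f^-1%FUN (i, j)) => //=.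
    by rewrite invK ?inE.
  rewrite -(esum_pred_image (box_volume \o uncurry G) _ xpredT)
    ?[fun=> _]set_true//.
  by rewrite image_eq.
rewrite (_ : esum _ _ = \sum_(i <oo) \sum_(j <oo) box_volume (G i j));
    last first.
  pose J : nat -> set (nat * nat) := fun i => [set (i, j) | j in setT].
  rewrite (_ : setT = \bigcup_k J k); last first.
    by rewrite predeqE => -[a b]; split => // _; exists a => //; exists b.
  rewrite esum_bigcupT /=; last 2 first.
    - apply/trivIsetP => i j _ _ ij.
      rewrite predeqE => -[k m] /=; split => //= -[] [_] _ [<-{k} _].
      by move=> [m' _] [] /esym/eqP; rewrite (negbTE ij).
    - by move=> /= [k m]; exact: box_volume_ge0.
  rewrite -(image_id [set: nat]) -fun_true esum_pred_image//; last first.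
    by move=> k _; apply: esum_ge0 => -[i j] _; exact: box_volume_ge0.
  apply: eq_eseriesr => /= j _.
  rewrite -(esum_pred_image (box_volume \o uncurry G) (pair j) predT)//=.
  - by congr esum; rewrite predeqE => -[a b]; split; move=> [i _ <-]; exists i.
  - by move=> k _; exact: box_volume_ge0.
  - by move=> ? ? _ _; exact: (@can_inj _ _ _ snd).
apply: lee_nneseries => k _; last exact: (PG k).2.
by move=> _; apply: nneseries_ge0 => m _ _; exact: (vG_ge0 (k, m)).
Qed.

HB.instance Definition _ := isOuterMeasure.Build R 'rV[R]_n lebesgue_outer
  lebesgue_outer0 lebesgue_outer_ge0 le_lebesgue_outer
  lebesgue_outer_sigma_subadditive.

End lebesgue_outer_measure.

HB.instance Definition _ (R : realType) (n : nat) :=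
  @isMeasurable.Build (caratheodory_display (@lebesgue_outer R n)) 'rV[R]_n
    (@lebesgue_outer R n).-caratheodory
    (caratheodory_measurable_set0 _)
    (@caratheodory_measurable_setC _ _ _)
    (@caratheodory_measurable_bigcup _ _ _).

Definition lebesgue_rV {R : realType} {n : nat} : set 'rV[R]_n -> \bar R :=
  lebesgue_outer.

HB.instance Definition _ (R : realType) (n : nat) :=
  isMeasure.Build _ 'rV[R]_n R (@lebesgue_rV R n)
    (@caratheodory_measure0 R 'rV[R]_n (@lebesgue_outer R n))
    (@caratheodory_measure_ge0 R 'rV[R]_n (@lebesgue_outer R n))
    (@caratheodory_measure_sigma_additive R 'rV[R]_n (@lebesgue_outer R n)).

(* Euler's integral for z > 0, extended to the other reals (poles excepted) by
   Gamma(z) = Gamma(z + m) / (z (z + 1) ... (z + m - 1)). *)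
Definition Gamma {R : realType} (z : R) : R :=
  let m := if 0 < z then 0%N else (Num.truncn (- z)).+1 in
  (\int[lebesgue_measure]_(t in `]0, +oo[) (t `^ (z + m%:R - 1) * expR (- t)))
  / \prod_(k < m) (z + k%:R).

Section nonlocal.
Context {R : realType} {n : nat}.
Variable s : R.
Implicit Types (x y : 'rV[R]_n) (E F Omega : set 'rV[R]_n).
Implicit Types (alpha beta u v : 'rV[R]_n -> R).
Local Notation mu := (@lebesgue_rV R n).

(* The library norm on 'rV[R]_n is the sup norm. *)
Definition euclid x : R := Num.sqrt (\sum_(i < n) x ord0 i ^+ 2).

(* Takes the value 0 (not +oo) on the diagonal, a null set. *)
Definition frac_kernel x y : R := (euclid (x - y) `^ (n%:R + s))^-1.

Definition c_ns : R :=
  2 `^ s * Gamma ((n%:R + s) / 2) / (pi `^ (n%:R / 2) * `|Gamma (- (s / 2))|).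

Local Open Scope ereal_scope.

Definition psi F x : \bar R := \int[mu]_(y in F) (frac_kernel x y)%:E.

Definition P_s Omega : \bar R :=
  2^-1%:E * \int[mu]_y \int[mu]_x
    (`|\1_Omega x - \1_Omega y| * frac_kernel x y)%:E.

Definition P_sL E Omega : \bar R :=
  2^-1%:E * \int[mu]_(y in Omega) \int[mu]_(x in Omega)
    (`|\1_E x - \1_E y| * frac_kernel x y)%:E.

Definition off_exterior Omega : set ('rV[R]_n * 'rV[R]_n) :=
  ~` (~` Omega `*` ~` Omega).

Definition in_W Omega alpha beta v : Prop :=
  [/\ measurable_fun [set: 'rV[R]_n] v,
      {ae mu, forall x, (~` Omega) x -> beta x = 0%R -> v x = 0%R} &
      \int[mu]_(x in Omega) (v x ^+ 2)%:E
      + \int[mu \x mu]_(p in off_exterior Omega)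
          (`|v p.1 - v p.2| ^+ 2 * frac_kernel p.1 p.2)%:E
      + \int[mu]_(x in ~` Omega `&` [set x | (0 < beta x)%R])
          (psi Omega x * (alpha x / beta x * v x ^+ 2)%:E)
      < +oo].

(* Variational solutions of phi + eps^s (-Delta)^(s/2) phi = chi_E in Omega,
   alpha phi + beta N~(phi) = 0 in the complement of Omega. *)
Definition is_solution Omega alpha beta (eps : R) E (phi : 'rV[R]_n -> R) :=
  in_W Omega alpha beta phi /\
  forall v, in_W Omega alpha beta v ->
    \int[mu]_(x in Omega) (phi x * v x)%:E
    + (eps `^ s * c_ns)%:E *
      (2^-1%:E * \int[mu \x mu]_(p in off_exterior Omega)
         ((phi p.1 - phi p.2) * (v p.1 - v p.2) * frac_kernel p.1 p.2)%:E
       + \int[mu]_(x in ~` Omega `&` [set x | (0 < beta x)%R])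
           (psi Omega x * (alpha x / beta x * phi x * v x)%:E))
    = \int[mu]_(x in Omega) (\1_E x * v x)%:E.

(* [phi eps E] stands for phi_E^eps. *)
Definition J_eps Omega (phi : R -> set 'rV[R]_n -> 'rV[R]_n -> R)
    (eps : R) E : \bar R :=
  (eps `^ (- s))%:E *
  \int[mu]_(x in Omega) (\1_E x * (1 - phi eps E x))%:E.

(* P_s Omega < +oo makes psi Omega finite a.e. outside Omega; extended-real
   conventions (0 * +oo = 0, 0^-1 = +oo) matter only on a null set or when
   Omega is empty. *)
Definition J_0 Omega alpha beta E : \bar R :=
  c_ns%:E *
  (P_sL E Omega
   + \int[mu]_(x in ~` Omega)
       ((alpha x / (alpha x + beta x))%:E * psi E x)
   + \int[mu]_(x in ~` Omega)
       ((beta x / (alpha x + beta x))%:E *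
        (psi (E `&` Omega) x * psi (~` E `&` Omega) x / psi Omega x))).

End nonlocal.

Section Gamma_convergence.
Context {R : realType} {n : nat}.
Implicit Types E Omega : set 'rV[R]_n.
Local Open Scope ereal_scope.

Definition measurable_subset Omega E := measurable E /\ E `<=` Omega.

Definition measurable_family Omega (E_ : R -> set 'rV[R]_n) :=
  forall eps : R, (0 < eps)%R -> measurable_subset Omega (E_ eps).

Definition cvg_L1 Omega (E_ : R -> set 'rV[R]_n) E :=
  \int[lebesgue_rV]_(x in Omega) (`|\1_(E_ eps) x - \1_E x : R|)%:E
    @[eps --> (0 : R)%R^'+] --> (0 : \bar R).

Definition liminf0 (f : R -> \bar R) := limf_einf f (0 : R)%R^'+.

Definition limsup0 (f : R -> \bar R) := limf_esup f (0 : R)%R^'+.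

Definition Gamma_cvg Omega (J : R -> set 'rV[R]_n -> \bar R)
    (J0 : set 'rV[R]_n -> \bar R) :=
  (forall (E_ : R -> set 'rV[R]_n) E,
     measurable_family Omega E_ -> measurable_subset Omega E ->
     cvg_L1 Omega E_ E -> J0 E <= liminf0 (fun eps => J eps (E_ eps))) /\
  (forall E, measurable_subset Omega E ->
     exists E_ : R -> set 'rV[R]_n, [/\ measurable_family Omega E_, cvg_L1 Omega E_ E &
       limsup0 (fun eps => J eps (E_ eps)) <= J0 E]).

End Gamma_convergence.

(* Main.v *)
Require Import Defs.
From HB Require Import structures.
From mathcomp Require Import all_boot all_order all_algebra.
From mathcomp Require Import all_classical all_reals all_analysis.
From mathcomp Require Import measurable_realfun ring lra.
Set Implicit Arguments.
Unset Strict Implicit.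
Unset Printing Implicit Defensive.
Import Order.TTheory GRing.Theory Num.Theory.
Import numFieldNormedType.Exports.
Local Open Scope classical_set_scope.
Local Open Scope ring_scope.

(** Testing the weak equation with [phi] itself gives, for [Q] the quadratic
    form of the problem,
      [J_eps E = eps^(-s) \int_Omega (phi - chi_E)^2 + c Q(phi)].
    Upper bound: take [w = chi_E] in [Omega] and, at an exterior point [x],
    let [w x] be the minimizer [t] of
      [\int_Omega (t - chi_E y)^2 k(x, y) dy + psi_Omega(x) (alpha / beta) t^2].
    Then [c Q(w) = J_0 E], and testing with [w] gives [J_eps E <= J_0 E].
    Lower bound: replace the kernel by a bounded kernel [k_m], vanishing for
    [x] outside a bounded set.  Since [chi_E] takes its values in {0, 1}, [Q] is
    then bounded below, pointwise under the integral signs, by the truncated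
    limit functional [L_m E] up to an error linear in the [L^1] distance:
      [L_m E <= Q(v) + C_m \int_Omega |v - chi_E|] for every [v].
    The part of the error coming from [|phi - chi_(E_eps)|] is absorbed by the
    penalization term, so [c L_m E <= liminf J_eps E_eps]; then let [m] tend to
    infinity by monotone convergence. *)

(** * Lebesgue measure on R^n *)

(** The obstacle in the lower bound is that the limit functional need not be continuous in [L^1] and
    the sets [E_eps] carry no perimeter bound. A kernel that is bounded and cut off in space removes
    the obstacle at the price of a constant [C_m], which grows with [m]; hence [m] is fixed while
    [eps] tends to 0. An error linear in the [L^1] distance is exactly what the penalization can
    absorb: [C |phi - chi| <= eps^(-s) (phi - chi)^2 + eps^s C^2], and the last term, integrated
    over the bounded set [Omega], tends to 0. Thus no compactness of the family [phi] enters. The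
    finite perimeter of [Omega] makes [psi_Omega] integrable outside [Omega], so off a null set the
    quotients of potentials in [J_0] are quotients of real numbers and the minimization at an
    exterior point is elementary algebra in one real unknown. *)

Section lebesgue_rV.
Context {R : realType} {n : nat}.
Implicit Types (A : set 'rV[R]_n) (x l u : 'rV[R]_n).
Local Open Scope ereal_scope.

Definition halfspace (i : 'I_n) (a : R) : set 'rV[R]_n :=
  [set x | (x ord0 i <= a)%R].

Definition set_coord x i (a : R) : 'rV[R]_n :=
  \row_j (if j == i then a else x ord0 j).

(** With half-open boxes, the hyperplane [x_i = a] cuts a box into two disjoint boxes of the same
    shape, the cut face going to the lower one. *)
Definition box_below i a (b : option ('rV[R]_n * 'rV[R]_n)) :=
  if b is Some (l, u) then Some (l, set_coord u i (Num.min (u ord0 i) a))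
  else None.

Definition box_above i a (b : option ('rV[R]_n * 'rV[R]_n)) :=
  if b is Some (l, u) then Some (set_coord l i (Num.max (l ord0 i) a), u)
  else None.

Lemma box_belowE i a b : box (box_below i a b) = box b `&` halfspace i a.
Proof.
case: b => [[l u]|] /=; last by rewrite set0I.
apply/seteqP; split=> x /=.
  move=> h; split; last first.
    by have := h i; rewrite !mxE eqxx le_min => /andP[_ /andP[]].
  move=> j; have := h j; rewrite !mxE; case: eqP => [->|//].
  by rewrite le_min => /andP[-> /andP[->]].
move=> [h xa] j; rewrite !mxE; case: eqP => [->|_]; last exact: h.
by rewrite le_min xa andbT; exact: h.
Qed.

Lemma box_aboveE i a b : box (box_above i a b) = box b `\` halfspace i a.
Proof.
case: b => [[l u]|] /=; last by rewrite set0D.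
apply/seteqP; split=> x /=.
  move=> h; split; last first.
    have := h i; rewrite !mxE eqxx gt_max => /andP[/andP[_ ?] _].
    by apply/negP; rewrite -ltNge.
  move=> j; have := h j; rewrite !mxE; case: eqP => [->|//].
  by rewrite gt_max => /andP[/andP[-> _] ->].
move=> [h /negP]; rewrite -ltNge => xa j.
rewrite !mxE; case: eqP => [->|_]; last exact: h.
by rewrite gt_max xa andbT; exact: h.
Qed.

Lemma box_volume_split i a b :
  box_volume b = box_volume (box_below i a b) + box_volume (box_above i a b).
Proof.
case: b => [[l u]|] /=; last by rewrite adde0.
rewrite -EFinD; congr EFin.
rewrite (bigD1 i)//= [in RHS](bigD1 i)//= [X in (_ = _ + X)%R](bigD1 i)//=.
rewrite !mxE !eqxx.
under [X in (_ = _ * X + _)%R]eq_bigr => j /negbTE ji do rewrite !mxE ji.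
under [X in (_ = _ + _ * X)%R]eq_bigr => j /negbTE ji do rewrite !mxE ji.
rewrite -mulrDl; congr (_ * _)%R.
by rewrite /Num.max /Num.min; do ! case: ifP; lra.
Qed.

(** Cutting each box of a cover of [X] yields covers of the two parts of [X] with the same total
    volume; this is the nontrivial inequality of the Caratheodory criterion. *)
Lemma measurable_halfspace i a : measurable (halfspace i a).
Proof.
apply: le_caratheodory_measurable => X /=.
apply: le_ereal_inf_tmp => _ [bs Xbs <-].
under eq_eseriesr do rewrite (box_volume_split i a).
rewrite nneseriesD; last 2 first.
- by move=> k _ _; exact: box_volume_ge0.
- by move=> k _ _; exact: box_volume_ge0.
apply: leeD.
- apply: ereal_inf_lbound; exists (box_below i a \o bs) => //= x [Xx xa].
  by have [k _ bk] := Xbs _ Xx; exists k => //; rewrite /= box_belowE.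
- apply: ereal_inf_lbound; exists (box_above i a \o bs) => //= x [Xx xa].
  by have [k _ bk] := Xbs _ Xx; exists k => //; rewrite /= box_aboveE.
Qed.

Lemma measurable_coord (i : 'I_n) :
  measurable_fun [set: 'rV[R]_n] (fun x => x ord0 i).
Proof.
apply: (measurability _ (RGenOInfty.measurableE R)) => _ [_ [a ->] <-].
rewrite setTI (_ : _ @^-1` _ = ~` halfspace i a).
  by apply: measurableC; exact: measurable_halfspace.
apply/seteqP; split=> x /=; rewrite in_itv/= andbT.
  by rewrite ltNge => /negP.
by move/negP; rewrite -ltNge.
Qed.

Lemma measurable_box l u : measurable (box (Some (l, u))).
Proof.
rewrite (_ : box _ = \bigcap_(i in [set: 'I_n])
    ((fun x => x ord0 i) @^-1` `]l ord0 i, u ord0 i])).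
  apply: fin_bigcap_measurable => // i _; rewrite -[_ @^-1` _]setTI.
  exact: measurable_coord.
by apply/seteqP; split=> x /=; [move=> h i _|move=> h i];
  have := h i; rewrite /= in_itv/= //; exact.
Qed.

(** There are countably many boxes with rational corners, and those inside an open set exhaust it: a
    ball of the sup norm is a cube, so rational corners around [x] can be chosen coordinate by
    coordinate. *)
Lemma open_measurable_rV A : open A -> measurable A.
Proof.
move=> oA.
pose q (p : 'rV[rat]_n * 'rV[rat]_n) :=
  box (Some (map_mx (@ratr R) p.1, map_mx (@ratr R) p.2)).
rewrite (_ : A = \bigcup_(p in [set p | q p `<=` A]) q p).
  rewrite bigcup_mkcond; apply: countable_bigcupT_measurable => [|p].
    exact: countableP.
  by case: ifP => // _; exact: measurable_box.
apply/seteqP; split=> [x Ax|x [p /= qA]]; last exact: qA.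
have /nbhs_ballP[e /= e0 xeA] : nbhs x A by exact: open_nbhs_nbhs.
have /choice[f fP] (i : 'I_n) : exists r : rat * rat,
    (x ord0 i - e < ratr r.1 < x ord0 i)%R /\
    (x ord0 i < ratr r.2 < x ord0 i + e)%R.
  have [r1] := @rat_in_itvoo R (x ord0 i - e) (x ord0 i) ltac:(lra).
  have [r2] := @rat_in_itvoo R (x ord0 i) (x ord0 i + e) ltac:(lra).
  by rewrite !in_itv/= => h1 h2; exists (r1, r2).
exists (\row_i (f i).1, \row_i (f i).2).
  move=> y /= h; apply: xeA; split=> // i j; rewrite (ord1 i).
  rewrite /ball/=; have := h j; rewrite !mxE.
  have [/andP[h1 h2] /andP[h3 h4]] := fP j => /andP[h5 h6].
  by rewrite distrC ltr_norml; apply/andP; split; lra.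
move=> i; rewrite !mxE; have [/andP[h1 h2] /andP[h3 h4]] := fP i.
by rewrite h2 ltW.
Qed.

Definition cube (m : nat) : set 'rV[R]_n :=
  box (Some (\row_i (- m%:R)%R, \row_i (m%:R)%R)).

Lemma measurable_cube m : measurable (cube m).
Proof. exact: measurable_box. Qed.

Lemma nondecreasing_cube : {homo cube : m p / (m <= p)%N >-> m `<=` p}.
Proof.
move=> m p mp x h i; have := h i; rewrite !mxE.
have : (m%:R <= p%:R :> R)%R by rewrite ler_nat.
by move=> ? /andP[? ?]; apply/andP; split; lra.
Qed.

Lemma bounded_sub_cube A : bounded_set A -> exists m, A `<=` cube m.
Proof.
(* [bounded_set] gives a bound only strictly above [M], hence [|M| + 1]. The successor makes the
   final inequality strict, as the open lower faces of the cube require. *)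
move=> [M [_ AM]]; exists (Num.truncn (`|M| + 1)).+1 => x Ax i.
rewrite !mxE.
have xM : (`|x| <= `|M| + 1)%R.
  by apply: AM => //; rewrite (le_lt_trans (ler_norm _))// ltrDl.
have Mm := truncnS_gt (`|M| + 1)%R.
have : (`|x ord0 i| <= `|x|)%R.
  rewrite (_ : `|x| = mx_norm x)%R// mx_normrE.
  by apply: le_trans (le_bigmax _ (fun ij => `|x ij.1 ij.2|)%R (ord0, i)).
rewrite ler_norml => /andP[h1 h2].
by apply/andP; split; lra.
Qed.

Lemma bigcup_cube : \bigcup_m cube m = setT.
Proof.
apply/seteqP; split=> // x _.
have [|m xm] := @bounded_sub_cube [set x].
  by exists `|x|%R; split => // M xM _ -> ; exact: ltW.
by exists m => //; exact: xm.
Qed.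

Lemma lebesgue_box_fin b : @lebesgue_rV R n (box b) < +oo.
Proof.
apply: (@le_lt_trans _ _ (box_volume b)); last first.
  by case: b => [[l u]|] /=; rewrite ltry.
(* A cover is an infinite sequence; the single box is padded with [None], which has volume 0 in
   every dimension. *)
apply: ereal_inf_lbound; exists (fun k : nat => if k == 0%N then b else None).
  by move=> x bx; exists 0%N.
rewrite (nneseries_split 0%N 1%N); last first.
  by move=> k _; exact: box_volume_ge0.
rewrite big_nat1 eseries0 ?adde0//.
by case.
Qed.

(** Sigma-finiteness is what gives access to the product measure and Tonelli's theorem. *)
Lemma lebesgue_rV_sigma_finite : sigma_finite setT (@lebesgue_rV R n).
Proof.
exists cube; first by rewrite bigcup_cube.
by move=> m; split; [exact: measurable_cube|exact: lebesgue_box_fin].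
Qed.

HB.instance Definition _ := @Measure_isSigmaFinite.Build _ _ _
  (@lebesgue_rV R n) lebesgue_rV_sigma_finite.

Lemma bounded_lebesgue_fin A : bounded_set A -> @lebesgue_rV R n A < +oo.
Proof.
move=> /bounded_sub_cube[m Am].
by apply: le_lt_trans (lebesgue_box_fin (Some _)); exact: le_lebesgue_outer Am.
Qed.

Lemma euclidC x y : euclid (x - y) = euclid (y - x).
Proof.
congr Num.sqrt; apply: eq_bigr => i _.
by rewrite !mxE -sqrrN opprB.
Qed.

Lemma frac_kernelC s x y : frac_kernel s x y = frac_kernel s y x.
Proof. by rewrite /frac_kernel euclidC. Qed.

Lemma frac_kernel_ge0 s x y : (0 <= frac_kernel s x y)%R.
Proof. by rewrite invr_ge0 powR_ge0. Qed.

Lemma measurable_frac_kernel s :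
  measurable_fun [set: 'rV[R]_n * 'rV[R]_n] (fun p => frac_kernel s p.1 p.2).
Proof.
have mq : measurable_fun [set: R] (@Num.sqrt R).
  exact: continuous_measurable_fun (@sqrt_continuous R).
have mS : measurable_fun [set: 'rV[R]_n * 'rV[R]_n]
    (fun p => \sum_(i < n) (p.1 - p.2) ord0 i ^+ 2)%R.
  apply: measurable_sum => i; apply: measurable_funX.
  under eq_fun do rewrite !mxE.
  by apply: measurable_funB;
    apply: (measurableT_comp (measurable_coord i)).
have mf : measurable_fun [set: 'rV[R]_n * 'rV[R]_n]
    (fun p => euclid (p.1 - p.2)) := measurableT_comp mq mS.
have mp : measurable_fun [set: R] (fun z : R => (z `^ (n%:R + s))^-1)%R.
  apply: (eq_measurable_fun (fun z : R => z `^ (- (n%:R + s)))%R).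
    by move=> z _; rewrite powRN.
  exact: measurable_powR.
exact: (measurableT_comp mp mf).
Qed.

End lebesgue_rV.

(** * Positivity of the normalizing constant *)

Section Gamma_gt0.
Context {R : realType}.
Local Notation leb := (@lebesgue_measure R).
Implicit Types (a : R).

(** The antiderivative is [t ^ a]. The bound is independent of [e], so it survives [e -> 0], where
    the integrand blows up if [a < 1]. *)
Lemma integral_powR_itv_le1 a (e : R) : 0 < a -> 0 < e -> e < 1 ->
  (\int[leb]_(t in `[e, 1%R]) (a * t `^ (a - 1))%:E <= 1)%E.
Proof.
move=> a0 e0 e1.
have pos x : x \in `[e, 1] -> 0 < x.
  by rewrite in_itv/= => /andP[+ _]; exact: lt_le_trans.
have dpow (p x : R) : 0 < x -> derivable (@powR R ^~ p) x 1.
  by move=> x0; apply: derivable_powR; rewrite in_itv/= x0.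
have cpow (p x : R) : 0 < x -> {for x, continuous (@powR R ^~ p)}.
  by move=> x0; apply: differentiable_continuous; exact/derivable1_diffP/dpow.
rewrite (@continuous_FTC2 _ _ (@powR R ^~ a))//.
- by rewrite powR1 -EFinB lee_fin gerBl powR_ge0.
- apply: derivable_within_continuous => x /pos x0.
  by apply: derivableM => //; exact: dpow.
- split; last 2 first.
  + by apply: cvg_at_right_filter; exact: cpow.
  + by apply: cvg_at_left_filter; apply: cpow.
  + move=> x; rewrite in_itv/= => /andP[ex _]; apply: dpow.
    exact: lt_trans ex.
- move=> x; rewrite in_itv/= => /andP[ex _].
  by rewrite powR_derive1// in_itv/= andbT (lt_trans e0).
Qed.

Lemma integral_powR01_lty a : 0 < a ->
  (\int[leb]_(t in `]0%R, 1%R]) (t `^ (a - 1))%:E < +oo)%E.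
Proof.
move=> a0.
(* The shift by 2 keeps the left end strictly below 1, as [integral_powR_itv_le1] asks. *)
pose F (i : nat) := [set` `[i.+2%:R^-1 : R, 1]].
have mp : measurable_fun [set: R] (fun t : R => (t `^ (a - 1))%:E).
  by apply/measurable_EFinP; exact: measurable_powR.
have UF : \bigcup_i F i = [set` `]0%R, 1%R]].
  apply/seteqP; split=> x /=.
    move=> [i _]; rewrite /F/= !in_itv/= => /andP[+ ->]; rewrite andbT.
    by apply: lt_le_trans; rewrite invr_gt0.
  rewrite in_itv/= => /andP[x0 x1]; exists (Num.truncn x^-1) => //.
  rewrite /F/= in_itv/= x1 andbT invf_ple ?posrE//.
  apply: ltW; apply: lt_trans (truncnS_gt _) _.
  by rewrite ltr_nat.
have mF i : measurable (F i) by exact: measurable_itv.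
have ndF : nondecreasing_seq F.
  move=> i j ij; apply/subsetPset => x; rewrite /F/= !in_itv/= => /andP[+ ->].
  rewrite andbT; apply: le_trans; rewrite lef_pV2 ?posrE//.
  by rewrite ler_nat.
have : (\int[leb]_(t in F i) (t `^ (a - 1))%:E @[i --> \oo] -->
    \int[leb]_(t in \bigcup_i F i) (t `^ (a - 1))%:E)%E.
  apply: ge0_nondecreasing_set_cvg_integral => // [i|i x _].
    exact: measurable_funTS.
  by rewrite lee_fin powR_ge0.
rewrite UF => cvgF; apply: (@le_lt_trans _ _ (a^-1)%:E); last exact: ltry.
rewrite -(cvg_lim _ cvgF)//; apply: lime_le.
  by apply/cvg_ex; eexists; exact: cvgF.
apply: nearW => i.
have i2 : (i.+2%:R^-1 < 1 :> R) by rewrite invf_lt1// ltr1n.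
have := @integral_powR_itv_le1 a _ a0 _ i2; rewrite invr_gt0 => /(_ (ltr0Sn _ _)).
under eq_integral do rewrite EFinM.
rewrite ge0_integralZl//; last 3 first.
- exact: measurable_funTS.
- by move=> x _; rewrite lee_fin powR_ge0.
- by rewrite lee_fin ltW.
by rewrite -lee_pdivlMl// mule1.
Qed.

(** Domination by a multiple of a probability density bounds the tail of the Gamma integral without
    computing any integral. *)
Lemma powR_le_expR a : exists2 C : R, 0 <= C &
  forall t, 1 <= t -> t `^ (a - 1) * expR (- t) <= C * exponential_pdf 2^-1 t.
Proof.
pose N := (Num.truncn `|a|).+1.
(* From [x <= expR x] at [x = t / (2 N)], raised to the power [N], comes
   [t ^ N <= (2 N) ^ N * expR (t / 2)]. The leading 2 cancels the rate 1/2 in front of the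
   density. *)
exists (2 * (2 * N%:R) ^+ N); first by rewrite mulr_ge0// exprn_ge0// mulr_ge0.
move=> t t1; have t0 : 0 <= t by exact: le_trans t1.
rewrite exponential_pdfE//.
have tN : t `^ (a - 1) <= t ^+ N.
  rewrite -powR_mulrn//; apply: ler_powR => //.
  have := truncnS_gt `|a|; have := ler_norm a; rewrite /N; lra.
have tE : t ^+ N <= (2 * N%:R) ^+ N * expR (t / 2).
  have -> : t / 2 = N%:R * (t / (2 * N%:R)) by field; rewrite pnatr_eq0.
  rewrite expRM_natl -exprMn ler_pXn2r ?nnegrE ?mulr_ge0 ?expR_ge0//.
  rewrite -ler_pdivrMl ?mulr_gt0// mulrC.
  by apply: le_trans (expR_ge1Dx _); rewrite lerDr.
apply: (@le_trans _ _ ((2 * N%:R) ^+ N * expR (t / 2) * expR (- t))).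
  by rewrite ler_wpM2r ?expR_ge0// (le_trans tN).
rewrite -mulrA -expRD; have -> : t / 2 + - t = - 2^-1 * t by field.
by rewrite [leRHS]mulrACA mulfV// mul1r.
Qed.

Lemma Gamma_integral_lty a : 0 < a ->
  (\int[leb]_(t in `]0%R, +oo[) (t `^ (a - 1) * expR (- t))%:E < +oo)%E.
Proof.
move=> a0.
have mE : measurable_fun [set: R] (fun t : R => expR (- t)).
  by apply: measurableT_comp => //; exact: measurable_expR.
have mf : measurable_fun [set: R] (fun t : R => (t `^ (a - 1) * expR (- t))%:E).
  by apply/measurable_EFinP; apply: measurable_funM => //; exact: measurable_powR.
have f0 (x : R) : (0 <= (x `^ (a - 1) * expR (- x))%:E)%E.
  by rewrite lee_fin mulr_ge0 ?powR_ge0 ?expR_ge0.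
have -> : `]0%R, +oo[%classic = `]0%R, 1%R] `|` `]1%R, +oo[ :> set R.
  by rewrite -itv_bndbnd_setU// bnd_simp.
rewrite ge0_integral_setU//=; last 2 first.
- exact: measurable_funTS.
- apply/disj_setPS => x [] /=; rewrite !in_itv/= andbT => /andP[_ x1].
  by rewrite ltNge x1.
apply: lte_add_pinfty.
  apply: le_lt_trans (integral_powR01_lty a0).
  apply: ge0_le_integral => //.
  - exact: measurable_funTS.
  - apply: measurable_funTS; apply/measurable_EFinP; exact: measurable_powR.
  - move=> x /=; rewrite in_itv/= => /andP[x0 _].
    rewrite lee_fin ler_piMr ?powR_ge0// -expR0 ler_expR oppr_le0; exact: ltW.
have [C C0 hC] := powR_le_expR a.
apply: (@le_lt_trans _ _
    (\int[leb]_(t in `]1%R, +oo[) (C%:E * (exponential_pdf 2^-1 t)%:E))%E).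
  apply: ge0_le_integral => //.
  - exact: measurable_funTS.
  - apply: measurable_funTS; apply: measurable_funeM; apply/measurable_EFinP.
    exact: measurable_exponential_pdf.
  - move=> x /=; rewrite in_itv/= andbT => x1.
    by rewrite -EFinM lee_fin hC// ltW.
have me : measurable_fun [set: R] (fun t => (exponential_pdf (2^-1 : R) t)%:E).
  by apply/measurable_EFinP; exact: measurable_exponential_pdf.
have e0 t : (0 <= (exponential_pdf (2^-1 : R) t)%:E)%E.
  by rewrite lee_fin exponential_pdf_ge0// invr_ge0.
rewrite ge0_integralZl//; last by exact: measurable_funTS.
apply: (@le_lt_trans _ _ (C%:E * 1)%E); last by rewrite mule1 ltry.
apply: lee_wpmul2l => //.
rewrite -(@integral_exponential_pdf R 2^-1)//.
exact: ge0_subset_integral.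
Qed.

Lemma Gamma_integral_gt0 a : 0 < a ->
  (0 < \int[leb]_(t in `]0%R, +oo[) (t `^ (a - 1) * expR (- t))%:E)%E.
Proof.
move=> a0.
have mf : measurable_fun [set: R] (fun t : R => (t `^ (a - 1) * expR (- t))%:E).
  apply/measurable_EFinP; apply: measurable_funM; first exact: measurable_powR.
  by apply: measurableT_comp => //; exact: measurable_expR.
have f0 (x : R) : (0 <= (x `^ (a - 1) * expR (- x))%:E)%E.
  by rewrite lee_fin mulr_ge0 ?powR_ge0 ?expR_ge0.
have leb12 : (leb `[1%R, 2%R] = 1)%E.
  by rewrite lebesgue_measure_itv/= lte_fin ltr1n -EFinB; congr EFin; lra.
(* On [[1, 2]], [a > 0] gives [t ^ (a - 1) >= t ^ (-1) >= 1/2], and [expR (- t) >= expR (- 2)]. *)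
apply: (@lt_le_trans _ _
    (\int[leb]_(t in `[1%R, 2%R]) (2^-1 * expR (- 2))%:E)%E).
  by rewrite integral_cst//= leb12 mule1 lte_fin mulr_gt0 ?expR_gt0// invr_gt0.
apply: (@le_trans _ _
    (\int[leb]_(t in `[1%R, 2%R]) (t `^ (a - 1) * expR (- t))%:E)%E).
  apply: ge0_le_integral => //.
  - exact: measurable_funTS.
  - move=> x /=; rewrite in_itv/= => /andP[x1 x2].
    rewrite lee_fin; apply: ler_pM; rewrite ?expR_ge0 ?invr_ge0//.
      apply: (@le_trans _ _ (x `^ (-1))).
        rewrite powR_inv1 ?(le_trans _ x1)// lef_pV2 ?posrE//.
        exact: lt_le_trans x1.
      by apply: ler_powR => //; lra.
    by rewrite ler_expR; lra.
apply: ge0_subset_integral => //; first exact: measurable_funTS.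
move=> x /=; rewrite !in_itv/= andbT => /andP[x1 _].
exact: lt_le_trans x1.
Qed.

(** The real-valued integral is 0 when the extended one is infinite, so positivity rests on
    finiteness too. *)
Lemma Gamma_Rintegral_gt0 a : 0 < a ->
  0 < \int[leb]_(t in `]0%R, +oo[) (t `^ (a - 1) * expR (- t)).
Proof.
move=> a0; have := Gamma_integral_lty a0; have := Gamma_integral_gt0 a0.
by rewrite /Rintegral; case: (integral _ _ _) => [r||]//=; rewrite lte_fin.
Qed.

Lemma Gamma_gt0 (z : R) : 0 < z -> 0 < Gamma z.
Proof.
move=> z0; rewrite /Gamma z0 big_ord0 divr1 addr0.
exact: Gamma_Rintegral_gt0.
Qed.

(** In this range the continuation shifts once: Euler's integral at [z + 1 > 0] is divided by
    [z < 0]. *)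
Lemma Gamma_lt0 (z : R) : -1 < z < 0 -> Gamma z < 0.
Proof.
move=> /andP[z1 z0]; have tr : Num.truncn (- z) = 0%N.
  have z0' : 0 <= - z by lra.
  by apply/eqP; rewrite truncn_eq//; apply/andP; split; lra.
have zF : (0 < z) = false by apply/negbTE; rewrite -leNgt ltW.
rewrite /Gamma zF tr.
rewrite big_ord1 addr0 pmulr_rlt0 ?invr_lt0//.
by apply: Gamma_Rintegral_gt0; lra.
Qed.

Lemma c_ns_gt0 (n : nat) (s : R) : 0 < s -> s < 1 -> 0 < c_ns (n := n) s.
Proof.
move=> s0 s1; have G1 : 0 < Gamma ((n%:R + s) / 2).
  by apply: Gamma_gt0; rewrite divr_gt0// ltr_wpDl.
have G2 : Gamma (- (s / 2)) < 0 by apply: Gamma_lt0; lra.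
have G3 : 0 < `|Gamma (- (s / 2))| by rewrite normr_gt0 ltr0_neq0.
by apply: divr_gt0; apply: mulr_gt0 => //; rewrite powR_gt0// pi_gt0.
Qed.

End Gamma_gt0.

(** * Integration lemmas *)

Lemma lty_pmull {R : realType} (r : R) (x : \bar R) : 0 < r ->
  (r%:E * x < +oo -> x < +oo)%E.
Proof.
move=> r0; case: x => [x _||]//; first exact: ltry.
by rewrite mulry gtr0_sg// mul1e.
Qed.

Lemma ereal_between {R : realType} (y x : \bar R) : (y < x)%E ->
  exists r : R, (y < r%:E < x)%E.
Proof.
case: y => [y||]; case: x => [x||]//.
- rewrite lte_fin => yx; exists ((y + x) / 2).
  by rewrite !lte_fin; apply/andP; split; lra.
- by move=> _; exists (y + 1); rewrite lte_fin ltry andbT; lra.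
- by move=> _; exists (x - 1); rewrite ltNyr lte_fin; lra.
- by move=> _; exists 0; rewrite ltNyr ltry.
Qed.

Section integral_lemmas.
Context {d} {T : measurableType d} {R : realType}.
Implicit Types (nu : {measure set T -> \bar R}) (A : set T).
Local Open Scope ereal_scope.

(** Here [f] may change sign without being integrable: dropping its negative part can only increase
    the integral, and [g] dominates its positive part. *)
Lemma le_integral_ge0 (nu : {measure set T -> \bar R}) (A : set T)
    (f g : T -> \bar R) : measurable A ->
  measurable_fun A f -> measurable_fun A g ->
  (forall x, A x -> 0 <= g x) -> (forall x, A x -> f x <= g x) ->
  \int[nu]_(x in A) f x <= \int[nu]_(x in A) g x.
Proof.
move=> mA mf mg g0 fg; rewrite integralE.
apply: (@le_trans _ _ (\int[nu]_(x in A) f^\+ x)).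
  by rewrite -[leRHS]sube0 leeB// integral_ge0.
apply: ge0_le_integral => //; first exact: measurable_funepos.
by move=> x Ax; rewrite funeposE ge_max fg// g0.
Qed.

(** Serves to bound a mixed term by two quadratic ones before the mixed term is known to be
    integrable. *)
Lemma integral_young (nu : {measure set T -> \bar R}) (A : set T)
    (f g h : T -> \bar R) : measurable A ->
  measurable_fun A f -> measurable_fun A g -> measurable_fun A h ->
  (forall x, A x -> 0 <= f x) -> (forall x, A x -> 0 <= g x) ->
  (forall x, A x -> h x <= 2^-1%:E * (f x + g x)) ->
  \int[nu]_(x in A) h x <=
  2^-1%:E * (\int[nu]_(x in A) f x + \int[nu]_(x in A) g x).
Proof.
move=> mA mf mg mh f0 g0 hfg.
rewrite -ge0_integralD// -ge0_integralZl//; last 2 first.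
- exact: emeasurable_funD.
- by move=> x Ax; rewrite adde_ge0 ?f0 ?g0.
apply: le_integral_ge0 => //.
- by apply: measurable_funeM; exact: emeasurable_funD.
- by move=> x Ax; rewrite mule_ge0// adde_ge0 ?f0 ?g0.
Qed.

Lemma cvg_ge0_integral (nu : {measure set T -> \bar R}) (A : set T)
    (g_ : nat -> T -> \bar R) (g : T -> \bar R) : measurable A ->
  (forall m, measurable_fun A (g_ m)) -> (forall m x, A x -> 0 <= g_ m x) ->
  (forall x, A x -> {homo g_ ^~ x : m p / (m <= p)%N >-> m <= p}) ->
  (forall x, A x -> g_ m x @[m --> \oo] --> g x) ->
  \int[nu]_(x in A) g_ m x @[m --> \oo] --> \int[nu]_(x in A) g x.
Proof.
move=> mA mg g0 ndg cvgg.
rewrite [X in _ --> X](_ : _ = \int[nu]_(x in A) limn (g_ ^~ x)).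
  exact: cvg_monotone_convergence.
apply: eq_integral => x; rewrite inE => Ax.
by apply/esym/cvg_lim => //; exact: cvgg.
Qed.

End integral_lemmas.

(** Triangle inequality through [g], then the weighted Young inequality
    [C y <= eta^-1 y^2 + eta C^2] for [y = |f x - g x|], which follows from [(y - eta C)^2 >= 0].
    With [eta = eps ^ s] the quadratic term becomes the penalization. *)
Lemma integral_dist_le {d} {T : measurableType d} {R : realType}
    (nu : {measure set T -> \bar R}) (A : set T) (f g h : T -> R) (C eta : R) :
  measurable A -> measurable_fun A f -> measurable_fun A g ->
  measurable_fun A h -> 0 <= C -> 0 < eta ->
  (C%:E * \int[nu]_(x in A) (`|f x - h x|)%:E <=
   eta^-1%:E * \int[nu]_(x in A) ((f x - g x) ^+ 2)%:E
   + (eta * C ^+ 2)%:E * nu A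
   + C%:E * \int[nu]_(x in A) (`|g x - h x|)%:E)%E.
Proof.
move=> mA mf mg mh C0 e0.
have mfh : measurable_fun A (fun x => (`|f x - h x|)%:E).
  by apply/measurable_EFinP; apply: measurableT_comp => //; exact: measurable_funB.
have mgh : measurable_fun A (fun x => (`|g x - h x|)%:E).
  by apply/measurable_EFinP; apply: measurableT_comp => //; exact: measurable_funB.
have mfg : measurable_fun A (fun x => ((f x - g x) ^+ 2)%:E).
  by apply/measurable_EFinP; apply: measurable_funX; exact: measurable_funB.
rewrite -integral_cst// -!ge0_integralZl//; last 2 first.
- by move=> x _; rewrite lee_fin sqr_ge0.
- by rewrite lee_fin invr_ge0 ltW.
rewrite -!ge0_integralD//; last 7 first.
- move=> x _ /=; rewrite -EFinM -EFinD lee_fin.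
  by rewrite addr_ge0// mulr_ge0 ?sqr_ge0 ?invr_ge0// ltW.
- by apply: emeasurable_funD => //; exact: measurable_funeM.
- by move=> x _; rewrite -EFinM lee_fin mulr_ge0.
- exact: measurable_funeM.
- by move=> x _; rewrite -EFinM lee_fin mulr_ge0 ?sqr_ge0// invr_ge0 ltW.
- exact: measurable_funeM.
- by move=> x _ /=; rewrite lee_fin mulr_ge0 ?sqr_ge0// ltW.
apply: ge0_le_integral => //.
- by move=> x _; rewrite -EFinM lee_fin mulr_ge0.
- exact: measurable_funeM.
- apply: emeasurable_funD; last exact: measurable_funeM.
  by apply: emeasurable_funD => //; exact: measurable_funeM.
move=> x _ /=; rewrite -!EFinM -!EFinD lee_fin.
have h1 : C * `|f x - h x| <= C * `|f x - g x| + C * `|g x - h x|.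
  by rewrite -mulrDr ler_wpM2l// -[in leLHS](subrKA (g x)) ler_normD.
apply: (le_trans h1); rewrite lerD2r.
rewrite -[(f x - g x) ^+ 2](@real_normK _ (f x - g x)) ?num_real//.
set y := `|f x - g x|; have y0 : 0 <= y by exact: normr_ge0.
rewrite -(ler_pM2l e0) mulrDr mulrA mulfV ?gt_eqF// mul1r.
have := sqr_ge0 (y - eta * C); have : 0 <= eta * C * y by rewrite !mulr_ge0// ltW.
nra.
Qed.

(** * Tonelli's theorem on rectangles and off the exterior square *)

Section product_integral.
Context {d} {T : measurableType d} {R : realType}.
Variable mu : {sigma_finite_measure set T -> \bar R}.
Local Open Scope ereal_scope.

Lemma integral_setX (A B : set T) (f : T * T -> \bar R) :
  measurable A -> measurable B -> measurable_fun setT f ->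
  (forall p, 0 <= f p) ->
  \int[mu \x mu]_(p in A `*` B) f p =
  \int[mu]_(x in A) \int[mu]_(y in B) f (x, y).
Proof.
move=> mA mB mf f0; rewrite integral_mkcond fubini_tonelli1; last 2 first.
- apply/(measurable_restrictT f); first exact: measurableX.
  exact: measurable_funTS.
- by move=> p; exact: erestrict_ge0.
rewrite [RHS]integral_mkcond; apply: eq_integral => x _.
rewrite /fubini_F patchE; case: ifPn => xA.
  rewrite [RHS]integral_mkcond; apply: eq_integral => y _.
  by rewrite !patchE in_setX xA.
by apply: integral0_eq => y _; rewrite patchE in_setX (negbTE xA).
Qed.

Lemma integral_setX_swap (A B : set T) (f : T * T -> \bar R) :
  measurable A -> measurable B -> measurable_fun setT f ->
  (forall p, 0 <= f p) ->
  \int[mu \x mu]_(p in A `*` B) f p =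
  \int[mu]_(y in B) \int[mu]_(x in A) f (x, y).
Proof.
move=> mA mB mf f0; rewrite integral_mkcond fubini_tonelli2; last 2 first.
- apply/(measurable_restrictT f); first exact: measurableX.
  exact: measurable_funTS.
- by move=> p; exact: erestrict_ge0.
rewrite [RHS]integral_mkcond; apply: eq_integral => y _.
rewrite /fubini_G patchE; case: ifPn => yB.
  rewrite [RHS]integral_mkcond; apply: eq_integral => x _.
  by rewrite !patchE in_setX yB andbT.
by apply: integral0_eq => x _; rewrite patchE in_setX (negbTE yB) andbF.
Qed.

Lemma measurable_integral_section (B : set T) (f : T * T -> \bar R) :
  measurable B -> measurable_fun setT f -> (forall p, 0 <= f p) ->
  measurable_fun setT (fun x => \int[mu]_(y in B) f (x, y)).
Proof.
move=> mB mf f0.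
apply: (eq_measurable_fun (fubini_F mu (f \_ (setT `*` B)))).
  move=> x _; rewrite /fubini_F [RHS]integral_mkcond; apply: eq_integral => y _.
  by rewrite !patchE in_setX in_setT.
apply: measurable_fun_fubini_tonelli_F.
  apply/(measurable_restrictT f); first exact: measurableX.
  exact: measurable_funTS.
by move=> p; exact: erestrict_ge0.
Qed.

(** The domain is [Om x Om] together with two mixed rectangles, which contribute equally by
    symmetry. The resulting 2 cancels the 1/2 in the energy. *)
Lemma integral_off_exterior (Om : set T) (f : T * T -> \bar R) :
  measurable Om -> measurable_fun setT f -> (forall p, 0 <= f p) ->
  (forall x y, f (x, y) = f (y, x)) ->
  \int[mu \x mu]_(p in ~` (~` Om `*` ~` Om)) f p =
  \int[mu \x mu]_(p in Om `*` Om) f p +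
  2%:E * \int[mu]_(x in ~` Om) \int[mu]_(y in Om) f (x, y).
Proof.
move=> mO mf f0 fC.
have mOc : measurable (~` Om) by exact: measurableC.
have -> : ~` (~` Om `*` ~` Om) = (Om `*` Om) `|` ((~` Om `*` Om) `|` (Om `*` ~` Om)).
  apply/seteqP; split => [[x y]/= h|[x y]/= [|[]]]; last 3 first.
  - by move=> [? _] [].
  - by move=> [_ ?] [_].
  - by move=> [? _] [].
  have [Ox|Ox] := pselect (Om x); have [Oy|Oy] := pselect (Om y).
  - by left.
  - by right; right.
  - by right; left.
  - by exfalso; apply: h.
rewrite ge0_integral_setU//; last 4 first.
- exact: measurableX.
- by apply: measurableU; exact: measurableX.
- exact: measurable_funTS.
- apply/disj_setPS => -[x y] /= [[Ox Oy] []] [h1 h2]; first exact: h1.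
  exact: h2.
congr (_ + _); rewrite ge0_integral_setU//; last 4 first.
- exact: measurableX.
- exact: measurableX.
- exact: measurable_funTS.
- by apply/disj_setPS => -[x y] /= [[Ox Oy] [h1 h2]]; exact: Ox.
rewrite integral_setX// integral_setX_swap//.
under [X in _ + X]eq_integral => y _ do under eq_integral do rewrite fC.
by rewrite -[(2%:E)]/((1 + 1)%:E) EFinD ge0_muleDl// mul1e.
Qed.

End product_integral.

Section inverse_measurable.
Context {d} {T : measurableType d} {R : realType}.

(** On nonnegative reals inversion is the power -1, even at 0, where both conventions give 0. *)
Lemma measurable_funV_ge0 (A : set T) (f : T -> R) : measurable_fun A f ->
  (forall x, A x -> 0 <= f x) -> measurable_fun A (fun x => (f x)^-1).
Proof.
move=> mf f0; apply: (eq_measurable_fun (fun x => f x `^ (-1))).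
  by move=> x; rewrite inE => Ax; rewrite powR_inv1// f0.
exact: (measurableT_comp (measurable_powR (-1)) mf).
Qed.

Lemma measurable_funeV_ge0 (A : set T) (f : T -> \bar R) : measurable_fun A f ->
  (forall x, A x -> 0 <= f x)%E -> measurable_fun A (fun x => (f x)^-1)%E.
Proof.
move=> mf f0.
(* [fine] sends [+oo] to 0, and [0 ^ (-1) = 0] is also the extended inverse of [+oo]; only the
   inverse of 0, which is [+oo], needs a separate case. *)
pose h (y : \bar R) := if (y == 0)%E then +oo%E else (fine y `^ (-1))%:E.
have mh : measurable_fun setT h.
  apply: measurable_fun_ifT => //.
    exact: measurable_fun_eqe.
  apply/measurable_EFinP.
  apply: (measurableT_comp (measurable_powR (-1))); exact: fine_measurable.
apply: (eq_measurable_fun (h \o f)); last exact: measurableT_comp.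
move=> x; rewrite inE /h/= => /f0.
case: (f x) => [r r0||]//=; last by rewrite powR0 ?oppr_eq0 ?oner_eq0.
by rewrite inver eqe; case: ifP => // _; rewrite powR_inv1.
Qed.

End inverse_measurable.

(** * The exterior density *)

Section exterior_mix.
Context {R : realFieldType}.
Implicit Types a b A B t : R.

(** With [A] and [B] the potentials of [E] and of the rest of [Om] at an exterior point, this is the
    minimum over the admissible [t] of the quadratic in [exterior_mix_min]. *)
Definition exterior_mix a b A B := a / (a + b) * A + b / (a + b) * (A * B / (A + B)).

(** Monotone convergence of the truncated functionals rests on this. After clearing denominators,
    the difference of the two quotients is [A A' (B' - B) + B B' (A' - A)]. *)
Lemma le_exterior_mix a b A A' B B' : 0 <= a -> 0 <= b -> 0 <= A -> 0 <= B ->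
  A <= A' -> B <= B' -> exterior_mix a b A B <= exterior_mix a b A' B'.
Proof.
move=> a0 b0 A0 B0 AA BB.
have A'0 := le_trans A0 AA; have B'0 := le_trans B0 BB.
apply: lerD; first by rewrite ler_wpM2l// divr_ge0// addr_ge0.
apply: ler_wpM2l; first by rewrite divr_ge0// addr_ge0.
have [S0|S0] := eqVneq (A + B) 0.
  by rewrite S0 invr0 mulr0 divr_ge0 ?mulr_ge0// addr_ge0.
have Sp : 0 < A + B by rewrite lt_def S0 addr_ge0.
have Sp' : 0 < A' + B' by lra.
rewrite ler_pdivrMr// mulrAC ler_pdivlMr//.
have h1 : 0 <= A * A' * (B' - B) by rewrite !mulr_ge0// subr_ge0.
have h2 : 0 <= B * B' * (A' - A) by rewrite !mulr_ge0// subr_ge0.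
rewrite -subr_ge0 (_ : _ - _ = A * A' * (B' - B) + B * B' * (A' - A)) ?addr_ge0//.
by ring.
Qed.

(** For [b > 0] and [A + B > 0] the right side exceeds the left by a square centred at the minimizer
    [b / (a + b) * (A / (A + B))]. For [b = 0] only [t = 0] is admissible; both sides are then [A],
    as [a / 0 = 0]. *)
Lemma exterior_mix_min a b A B t : 0 <= a -> 0 <= b -> 0 < a + b ->
  0 <= A -> 0 <= B -> (b = 0 -> t = 0) ->
  exterior_mix a b A B <=
  (t - 1) ^+ 2 * A + t ^+ 2 * B + (A + B) * (a / b * t ^+ 2).
Proof.
move=> a0 b0 ab0 A0 B0 bt; rewrite /exterior_mix.
have [b00|bn0] := eqVneq b 0.
  rewrite bt// b00 addr0 in ab0 *; rewrite divff ?gt_eqF//; lra.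
have bp : 0 < b by rewrite lt_def bn0.
have [S0|S0] := eqVneq (A + B) 0.
  have -> : A = 0 by lra.
  have -> : B = 0 by lra.
  by rewrite !(mulr0, mul0r, addr0).
have Sp : 0 < A + B by rewrite lt_def S0 addr_ge0.
rewrite -subr_ge0 (_ : _ - _ =
  (A + B) * (1 + a / b) * (t - b / (a + b) * (A / (A + B))) ^+ 2).
  by apply: mulr_ge0; [apply: mulr_ge0|exact: sqr_ge0];
    rewrite addr_ge0// divr_ge0.
by field; rewrite bn0 S0 gt_eqF.
Qed.

Lemma exterior_mix_eq a b A B : 0 <= a -> 0 <= b -> 0 < a + b ->
  0 <= A -> 0 <= B -> let t := b / (a + b) * (A / (A + B)) in
  (t - 1) ^+ 2 * A + t ^+ 2 * B + (A + B) * (a / b * t ^+ 2) =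
  exterior_mix a b A B.
Proof.
move=> a0 b0 ab0 A0 B0 t; rewrite /t /exterior_mix.
have [b00|bn0] := eqVneq b 0.
  rewrite b00 addr0 in ab0 *; rewrite divff ?gt_eqF//.
  by rewrite !mul0r; ring.
have [S0|S0] := eqVneq (A + B) 0.
  have -> : A = 0 by lra.
  have -> : B = 0 by lra.
  by rewrite !(mulr0, mul0r, addr0).
by field; rewrite bn0 S0 gt_eqF.
Qed.

Definition clamp01 t : R := Num.min (Num.max 0 t) 1.

Lemma clamp01_sqr t : clamp01 t ^+ 2 <= t ^+ 2.
Proof. by rewrite /clamp01 /Num.max /Num.min; do ! case: ifP; nra. Qed.

(** Without the clamp the error [(t - e)^2 - (t - w)^2 = (w - e) (2 t - e - w)] would grow with [t].
    For [t] in [[0, 1]] and [e] in {0, 1}, [(t - e) (w - e) <= |w - e|], which makes the error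
    linear and uniform in [t]. *)
Lemma clamp01_approx t e w : e = 0 \/ e = 1 ->
  (clamp01 t - e) ^+ 2 <= (t - w) ^+ 2 + 2 * `|w - e|.
Proof.
move=> he.
have m0 := normr_ge0 (w - e).
have [m1 m2] : - `|w - e| <= w - e /\ w - e <= `|w - e|.
  by apply/andP; rewrite -ler_norml.
move: `|w - e| m0 m1 m2 => m m0 m1 m2.
have [t1|t1] := lerP t 1; last first.
  have -> : clamp01 t = 1 by rewrite /clamp01 /Num.max /Num.min; do ! case: ifP; lra.
  case: he m1 m2 => -> m1 m2; have := sqr_ge0 (t - w - 1); have := sqr_ge0 (t - w); nra.
have [t0|t0] := lerP 0 t; last first.
  have -> : clamp01 t = 0 by rewrite /clamp01 /Num.max /Num.min; do ! case: ifP; lra.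
  case: he m1 m2 => -> m1 m2; have := sqr_ge0 (t - w + 1); have := sqr_ge0 (t - w); nra.
have -> : clamp01 t = t by rewrite /clamp01 /Num.max /Num.min; do ! case: ifP; lra.
have tm : 0 <= t * m by exact: mulr_ge0.
have tm1 : 0 <= (1 - t) * m by rewrite mulr_ge0// subr_ge0.
have twe : (t - e) * (w - e) <= m.
  case: he m1 m2 => -> m1 m2.
    have : 0 <= t * (m - w) by rewrite mulr_ge0//; lra.
    lra.
  have : 0 <= (1 - t) * (m + (w - 1)) by rewrite mulr_ge0//; lra.
  lra.
have := sqr_ge0 (w - e).
have -> : (t - w) ^+ 2 =
    (t - e) ^+ 2 - 2 * ((t - e) * (w - e)) + (w - e) ^+ 2 by ring.
lra.
Qed.

(** If [e] and [f] differ, then [d = |u - w|] is at least [1 - |u - e| - |w - f|], and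
    [d^2 >= 2 d - 1] turns the square into a linear expression. *)
Lemma indic_approx (e f u w : R) : (e = 0 \/ e = 1) -> (f = 0 \/ f = 1) ->
  `|e - f| <= (u - w) ^+ 2 + (2 : R) * `|u - e| + 2 * `|w - f|.
Proof.
move=> he hf.
have h1 := normr_ge0 (u - e); have h2 := normr_ge0 (w - f).
have := ler_norm (u - e); have := ler_norm (- (u - e)); rewrite normrN.
have := ler_norm (w - f); have := ler_norm (- (w - f)); rewrite normrN.
move: `|u - e| `|w - f| h1 h2 => m p m0 p0 p1 p2 m1 m2.
have s0 := sqr_ge0 (u - w); have s1 := sqr_ge0 (u - w + 1).
have s2 := sqr_ge0 (u - w - 1).
have n01 : `|0 - 1| = 1 :> R by rewrite sub0r normrN normr1.
have n10 : `|1 - 0| = 1 :> R by rewrite subr0 normr1.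
case: he m1 m2 => -> m1 m2; case: hf p1 p2 => -> p1 p2.
- rewrite (_ : 0 - 0 = 0 :> R) ?subr0// normr0; lra.
- rewrite n01; nra.
- rewrite n10; nra.
- rewrite (_ : 1 - 1 = 0 :> R) ?subrr// normr0; lra.
Qed.

End exterior_mix.

Lemma cvg_exterior_mix {R : realType} (a b : R) (A_ B_ : nat -> R) (A B : R) :
  (forall m, 0 <= A_ m <= A) -> (forall m, 0 <= B_ m <= B) ->
  A_ m @[m --> \oo] --> A -> B_ m @[m --> \oo] --> B ->
  exterior_mix a b (A_ m) (B_ m) @[m --> \oo] --> exterior_mix a b A B.
Proof.
move=> hA hB cA cB; apply: cvgD; first exact: cvgM (cvg_cst _) cA.
apply: cvgM; first exact: cvg_cst.
(* Inversion is discontinuous at 0, but there the bounds force [A_ m = 0], so the quotient is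
   constantly 0. *)
have [S0|S0] := eqVneq (A + B) 0.
  have A00 : A = 0 by have := hA 0%N; have := hB 0%N; lra.
  apply: cvg_near_cst; apply: nearW => m.
  have -> : A_ m = 0 by have := hA m; lra.
  by rewrite A00 !mul0r.
by apply: cvgM; [exact: cvgM|apply: cvgV => //; exact: cvgD].
Qed.

(** * Energies of a symmetric kernel on a measure space *)

Section nonlocal_energy.
Context {d} {T : measurableType d} {R : realType}.
Variable mu : {sigma_finite_measure set T -> \bar R}.
Local Open Scope ereal_scope.
Variables (Om : set T) (a b : T -> R).
Hypothesis mOm : measurable Om.
Hypothesis Om_fin : mu Om < +oo.
Hypothesis ma : measurable_fun (~` Om) a.
Hypothesis mb : measurable_fun (~` Om) b.
Hypothesis a_ge0 : forall x, (~` Om) x -> (0 <= a x)%R.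
Hypothesis b_ge0 : forall x, (~` Om) x -> (0 <= b x)%R.
Hypothesis ab_gt0 : forall x, (~` Om) x -> (0 < a x + b x)%R.
Implicit Types (k : T -> T -> R) (v : T -> R) (E F : set T).

Definition potential k F x : \bar R := \int[mu]_(y in F) (k x y)%:E.

Definition nonlocal_energy k v : \bar R :=
  2^-1%:E * \int[mu \x mu]_(p in ~` (~` Om `*` ~` Om))
    ((v p.1 - v p.2) ^+ 2 * k p.1 p.2)%:E
  + \int[mu]_(x in ~` Om) (potential k Om x * (a x / b x * v x ^+ 2)%:E).

Definition exterior_density k E x : \bar R :=
  (a x / (a x + b x))%:E * potential k E x
  + (b x / (a x + b x))%:E *
    (potential k (E `&` Om) x * potential k (~` E `&` Om) x / potential k Om x).

Definition limit_energy k E : \bar R :=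
  2^-1%:E * \int[mu \x mu]_(p in Om `*` Om)
    (`|\1_E p.1 - \1_E p.2| * k p.1 p.2)%:E
  + \int[mu]_(x in ~` Om) exterior_density k E x.

(** * Potentials, exterior densities and the optimal competitor *)

Section kernel.
Variable k : T -> T -> R.
Hypothesis mk : measurable_fun [set: T * T] (fun p => k p.1 p.2).
Hypothesis k_ge0 : forall x y, (0 <= k x y)%R.

Lemma measurable_potential F : measurable F ->
  measurable_fun setT (potential k F).
Proof.
move=> mF.
apply: (@measurable_integral_section _ _ _ mu F
  (fun p => (k p.1 p.2)%:E)) => //.
  exact/measurable_EFinP.
by move=> p; rewrite lee_fin.
Qed.

Lemma potential_ge0 F x : 0 <= potential k F x.
Proof. by apply: integral_ge0 => y _; rewrite lee_fin. Qed.

Lemma measurable_kernel_section x F : measurable_fun F (fun y => (k x y)%:E).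
Proof.
apply/measurable_EFinP; apply: measurable_funTS.
exact: (measurableT_comp mk (pair1_measurable x)).
Qed.

Lemma le_potential F G x : measurable F -> measurable G -> F `<=` G ->
  potential k F x <= potential k G x.
Proof.
move=> mF mG FG; apply: ge0_subset_integral => //.
- exact: measurable_kernel_section.
- by move=> y _; rewrite lee_fin.
Qed.

Lemma potential_split E x : measurable E -> E `<=` Om ->
  potential k Om x = potential k E x + potential k (~` E `&` Om) x.
Proof.
move=> mE EO; rewrite {1}(_ : Om = E `|` (~` E `&` Om)); last first.
  rewrite setUIr setUv setTI; apply/esym/setUidPr; exact: EO.
rewrite /potential ge0_integral_setU//.
- by apply: measurableI => //; exact: measurableC.
- exact: measurable_kernel_section.
- by move=> y _; rewrite lee_fin.
- by apply/disj_setPS => y /= [Ey [nEy _]]; exact: nEy.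
Qed.

Lemma integral_sqr_indic (t : R) E x : measurable E -> E `<=` Om ->
  \int[mu]_(y in Om) ((t - \1_E y) ^+ 2 * k x y)%:E =
  ((t - 1) ^+ 2)%:E * potential k E x + (t ^+ 2)%:E * potential k (~` E `&` Om) x.
Proof.
move=> mE EO; rewrite {1}(_ : Om = E `|` (~` E `&` Om)); last first.
  rewrite setUIr setUv setTI; apply/esym/setUidPr; exact: EO.
have mEc : measurable (~` E `&` Om).
  by apply: measurableI => //; exact: measurableC.
rewrite /potential ge0_integral_setU//; last 3 first.
- apply/measurable_EFinP; apply: measurable_funM.
    by apply: measurable_funX; apply: measurable_funB.
  exact/measurable_EFinP/measurable_kernel_section.
- by move=> y _; rewrite lee_fin mulr_ge0// sqr_ge0.
- by apply/disj_setPS => y /= [Ey [nEy _]]; exact: nEy.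
rewrite -!ge0_integralZl//; last 6 first.
- exact: measurable_kernel_section.
- by move=> y _; rewrite lee_fin.
- by rewrite lee_fin sqr_ge0.
- exact: measurable_kernel_section.
- by move=> y _; rewrite lee_fin.
- by rewrite lee_fin sqr_ge0.
congr (_ + _); apply: eq_integral => y; rewrite inE => yE; rewrite EFinM indicE.
  by rewrite mem_set.
by rewrite memNset ?subr0//; case: yE.
Qed.

Lemma exterior_density_ge0 E x : (~` Om) x -> 0 <= exterior_density k E x.
Proof.
move=> Ox; have ? := a_ge0 Ox; have ? := b_ge0 Ox.
have := potential_ge0 => h; apply: adde_ge0; apply: mule_ge0 => //.
- by rewrite lee_fin divr_ge0// addr_ge0.
- by rewrite lee_fin divr_ge0// addr_ge0.
by rewrite !mule_ge0// inve_ge0.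
Qed.

Lemma potential_fin_numW E x : measurable E -> E `<=` Om ->
  potential k Om x < +oo -> potential k E x \is a fin_num.
Proof.
move=> mE EO Pfin; rewrite ge0_fin_numE ?potential_ge0//.
by apply: le_lt_trans Pfin; exact: le_potential.
Qed.

Lemma potential_split_fine E x : measurable E -> E `<=` Om ->
  potential k Om x < +oo -> exists A B : R,
  [/\ (0 <= A)%R, (0 <= B)%R, potential k E x = A%:E,
      potential k (~` E `&` Om) x = B%:E & potential k Om x = (A + B)%:E].
Proof.
move=> mE EO Pfin.
have mEc : measurable (~` E `&` Om).
  by apply: measurableI => //; exact: measurableC.
have fE := potential_fin_numW mE EO Pfin.
have fEc : potential k (~` E `&` Om) x \is a fin_num.
  by apply: potential_fin_numW => // y [].
exists (fine (potential k E x)), (fine (potential k (~` E `&` Om) x)).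
by rewrite EFinD !fineK// -potential_split//;
  split=> //; apply: fine_ge0; exact: potential_ge0.
Qed.

Lemma exterior_densityE E x : measurable E -> E `<=` Om ->
  potential k Om x < +oo ->
  exterior_density k E x =
  (exterior_mix (a x) (b x) (fine (potential k E x))
                 (fine (potential k (~` E `&` Om) x)))%:E.
Proof.
move=> mE EO /(potential_split_fine mE EO)[A [B [A0 B0 PE PEc PO]]].
rewrite /exterior_density (setIidl EO) PE PEc PO/= inver.
(* For [A + B = 0] the extended inverse is [+oo] and the real one is 0; the numerators vanish, so
   both quotients are 0. *)
have [S0|S0] := eqVneq (A + B)%R 0%R.
  have -> : A = 0%R by lra.
  by rewrite /exterior_mix !(mul0r, mulr0, addr0, mul0e, mule0, adde0).
by rewrite -!EFinM -EFinD.
Qed.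

Lemma measurable_exterior_density E : measurable E -> E `<=` Om ->
  measurable_fun (~` Om) (exterior_density k E).
Proof.
move=> mE EO.
have mEc : measurable (~` E `&` Om).
  by apply: measurableI => //; exact: measurableC.
have mabV : measurable_fun (~` Om) (fun x => (a x + b x)^-1)%R.
  apply: measurable_funV_ge0; first exact: measurable_funD.
  by move=> x Ox; rewrite addr_ge0 ?a_ge0 ?b_ge0.
apply: emeasurable_funD; apply: emeasurable_funM.
- by apply/measurable_EFinP; exact: measurable_funM.
- exact/measurable_funTS/measurable_potential.
- by apply/measurable_EFinP; exact: measurable_funM.
- apply: emeasurable_funM; first apply: emeasurable_funM.
  + by apply/measurable_funTS/measurable_potential; exact: measurableI.
  + exact/measurable_funTS/measurable_potential.
  + apply: measurable_funeV_ge0; first exact/measurable_funTS/measurable_potential.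
    by move=> x _; exact: potential_ge0.
Qed.

Lemma integral_exterior_density E : measurable E -> E `<=` Om ->
  \int[mu]_(x in ~` Om) exterior_density k E x =
  \int[mu]_(x in ~` Om) ((a x / (a x + b x))%:E * potential k E x) +
  \int[mu]_(x in ~` Om) ((b x / (a x + b x))%:E *
    (potential k (E `&` Om) x * potential k (~` E `&` Om) x / potential k Om x)).
Proof.
move=> mE EO.
have mOc : measurable (~` Om) by exact: measurableC.
have mEc : measurable (~` E `&` Om).
  by apply: measurableI => //; exact: measurableC.
have mabV : measurable_fun (~` Om) (fun x => (a x + b x)^-1)%R.
  apply: measurable_funV_ge0; first exact: measurable_funD.
  by move=> x Ox; rewrite addr_ge0 ?a_ge0 ?b_ge0.
apply: ge0_integralD => //.
- move=> x Ox; rewrite mule_ge0 ?potential_ge0// lee_fin divr_ge0 ?a_ge0//.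
  exact/ltW/ab_gt0.
- apply: emeasurable_funM; first by apply/measurable_EFinP; exact: measurable_funM.
  exact/measurable_funTS/measurable_potential.
- move=> x Ox; rewrite mule_ge0//.
    by rewrite lee_fin divr_ge0 ?b_ge0//; exact/ltW/ab_gt0.
  by rewrite !mule_ge0 ?inve_ge0 ?potential_ge0.
- apply: emeasurable_funM; first by apply/measurable_EFinP; exact: measurable_funM.
  apply: emeasurable_funM; first apply: emeasurable_funM.
  + by apply/measurable_funTS/measurable_potential => //; exact: measurableI.
  + exact/measurable_funTS/measurable_potential.
  + apply: measurable_funeV_ge0; first exact/measurable_funTS/measurable_potential.
    by move=> x _; exact: potential_ge0.
Qed.

Lemma exterior_density_le (t : R) E x : measurable E -> E `<=` Om ->
  potential k Om x < +oo -> (~` Om) x -> (b x = 0%R -> t = 0%R) ->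
  exterior_density k E x <=
  \int[mu]_(y in Om) ((t - \1_E y) ^+ 2 * k x y)%:E
  + potential k Om x * (a x / b x * t ^+ 2)%:E.
Proof.
move=> mE EO Pfin Ox bt; rewrite exterior_densityE// integral_sqr_indic//.
have [A [B [A0 B0 -> -> ->]]] := potential_split_fine mE EO Pfin.
rewrite -!EFinM -!EFinD lee_fin.
exact: exterior_mix_min (a_ge0 Ox) (b_ge0 Ox) (ab_gt0 Ox) A0 B0 bt.
Qed.

(** Where the potential of [Om] is infinite, [fine] makes the exterior value 0; where [b] vanishes,
    the factor [b x] does, as membership in the energy space requires. *)
Definition competitor E x : R :=
  if x \in Om then \1_E x
  else (b x / (a x + b x) *
        (fine (potential k E x) / fine (potential k Om x)))%R.

Lemma measurable_competitor E : measurable E -> measurable_fun setT (competitor E).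
Proof.
move=> mE.
have mabV : measurable_fun (~` Om) (fun x => (a x + b x)^-1)%R.
  apply: measurable_funV_ge0; first exact: measurable_funD.
  by move=> x Ox; rewrite addr_ge0 ?a_ge0 ?b_ge0.
have mfin F : measurable F -> measurable_fun (~` Om) (fun x => fine (potential k F x)).
  move=> mF; apply: (measurableT_comp (fine_measurable _)) => //.
  exact/measurable_funTS/measurable_potential.
apply: measurable_fun_if => //.
- apply: (measurable_fun_bool true); rewrite setTI (_ : _ @^-1` _ = Om)//.
  by apply/seteqP; split=> x /= h; [exact: set_mem|exact: mem_set].
- rewrite setTI (_ : _ @^-1` _ = ~` Om); last first.
    apply/seteqP; split=> x /=; last by move=> ?; exact: memNset.
    by move=> /negbT; rewrite notin_setE.
  apply: measurable_funM; first exact: measurable_funM.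
  apply: measurable_funM; first exact: mfin.
  apply: measurable_funV_ge0; first exact: mfin.
  by move=> x _; rewrite fine_ge0// potential_ge0.
Qed.

Lemma competitor_in E x : Om x -> competitor E x = \1_E x.
Proof. by move=> Ox; rewrite /competitor mem_set. Qed.

Lemma competitor_itv E x : measurable E -> E `<=` Om ->
  (0 <= competitor E x <= 1)%R.
Proof.
move=> mE EO; rewrite /competitor; case: ifPn => [_|].
  by rewrite indicE; case: (x \in E) => /=; rewrite ?ler01 ?lexx.
rewrite notin_setE => Ox; have a0 := a_ge0 Ox; have b0 := b_ge0 Ox.
have ab0 := ab_gt0 Ox.
have [->|PO] := eqVneq (potential k Om x) +oo.
  by rewrite /= invr0 !mulr0 lexx ler01.
have := potential_split_fine mE EO; rewrite -ltey in PO => /(_ _ PO).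
move=> [A [B [A0 B0 -> _ ->]]] /=.
have h1 : (0 <= b x / (a x + b x) <= 1)%R.
  by rewrite divr_ge0 ?addr_ge0//= ler_pdivrMr// mul1r lerDr.
have h2 : (0 <= A / (A + B) <= 1)%R.
  rewrite divr_ge0 ?addr_ge0//=.
  have [->|S0] := eqVneq (A + B)%R 0%R; first by rewrite invr0 mulr0.
  by rewrite ler_pdivrMr ?lt_def ?S0 ?addr_ge0// mul1r lerDl.
move: h1 h2 => /andP[h1 h2] /andP[h3 h4].
by rewrite mulr_ge0//= mulr_ile1.
Qed.

Lemma exterior_density_competitor E x : measurable E -> E `<=` Om ->
  potential k Om x < +oo -> (~` Om) x ->
  \int[mu]_(y in Om) ((competitor E x - \1_E y) ^+ 2 * k x y)%:E
  + potential k Om x * (a x / b x * competitor E x ^+ 2)%:E =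
  exterior_density k E x.
Proof.
move=> mE EO Pfin Ox; rewrite exterior_densityE// integral_sqr_indic//.
rewrite /competitor memNset//.
have [A [B [A0 B0 -> -> ->]]] := potential_split_fine mE EO Pfin.
rewrite -!EFinM -!EFinD/=; congr EFin.
exact: exterior_mix_eq (a_ge0 Ox) (b_ge0 Ox) (ab_gt0 Ox) A0 B0.
Qed.

Lemma measurable_dirichlet v : measurable_fun setT v ->
  measurable_fun [set: T * T] (fun p => ((v p.1 - v p.2) ^+ 2 * k p.1 p.2)%:E).
Proof.
move=> mv; apply/measurable_EFinP; apply: measurable_funM => //.
by apply: measurable_funX; apply: measurable_funB;
  exact: measurableT_comp.
Qed.

Lemma measurable_boundary_term v : measurable_fun setT v ->
  measurable_fun (~` Om)
    (fun x => potential k Om x * (a x / b x * v x ^+ 2)%:E).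
Proof.
move=> mv; apply: emeasurable_funM.
  exact/measurable_funTS/measurable_potential.
apply/measurable_EFinP; apply: measurable_funM.
  by apply: measurable_funM => //; apply: measurable_funV_ge0.
exact/measurable_funX/measurable_funTS.
Qed.

Lemma boundary_term_ge0 v x : (~` Om) x ->
  0 <= potential k Om x * (a x / b x * v x ^+ 2)%:E.
Proof.
move=> Ox; rewrite mule_ge0 ?potential_ge0// lee_fin mulr_ge0 ?sqr_ge0//.
by rewrite divr_ge0 ?a_ge0 ?b_ge0.
Qed.

Hypothesis kC : forall x y, k x y = k y x.

(** Gathers all that depends on the exterior value [v x] into one integrand, so that the
    minimization over [t = v x] can be carried out separately at each exterior point. *)
Lemma nonlocal_energy_split v : measurable_fun setT v ->
  nonlocal_energy k v =
  2^-1%:E * \int[mu \x mu]_(p in Om `*` Om)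
    ((v p.1 - v p.2) ^+ 2 * k p.1 p.2)%:E
  + \int[mu]_(x in ~` Om)
      (\int[mu]_(y in Om) ((v x - v y) ^+ 2 * k x y)%:E
       + potential k Om x * (a x / b x * v x ^+ 2)%:E).
Proof.
move=> mv; have mD := measurable_dirichlet mv.
have D0 p : 0 <= ((v p.1 - v p.2) ^+ 2 * k p.1 p.2)%:E.
  by rewrite lee_fin mulr_ge0// sqr_ge0.
rewrite /nonlocal_energy integral_off_exterior//; last first.
  by move=> x y /=; rewrite kC -sqrrN opprB.
rewrite [X in _ = _ + X]ge0_integralD//; last 5 first.
- exact: measurableC.
- by move=> x _; apply: integral_ge0 => y _; exact: (D0 (x, y)).
- apply: measurable_funTS.
  exact: (measurable_integral_section _ mOm mD D0).
- by move=> x Ox; exact: boundary_term_ge0.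
- exact: measurable_boundary_term.
rewrite ge0_muleDr; last 2 first.
- by apply: integral_ge0.
- rewrite mule_ge0//; apply: integral_ge0 => x _.
  by apply: integral_ge0 => y _; exact: (D0 (x, y)).
have h2 : 2^-1%:E * 2%:E = 1 :> \bar R by rewrite -EFinM mulVf.
rewrite [X in _ + X + _]muleA h2 mul1e.
exact: (esym (addeA _ _ _)).
Qed.

(** On pairs with exactly one point in [Om] the jump equals 1. Finite perimeter thus makes the
    exterior potential integrable. *)
Lemma integral_exterior_potential_le :
  \int[mu]_(x in ~` Om) potential k Om x <=
  \int[mu]_y \int[mu]_x (`|\1_Om x - \1_Om y| * k x y)%:E.
Proof.
have mOc : measurable (~` Om) by exact: measurableC.
have mi : measurable_fun [set: T] (\1_Om : T -> R) by [].
have mj : measurable_fun [set: T * T]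
    (fun p => (`|\1_Om p.1 - \1_Om p.2| * k p.1 p.2)%:E).
  apply/measurable_EFinP; apply: measurable_funM => //.
  apply: measurableT_comp => //; apply: measurable_funB.
    exact: (measurableT_comp mi).
  exact: (measurableT_comp mi).
have j0 (p : T * T) : 0 <= (`|\1_Om p.1 - \1_Om p.2| * k p.1 p.2)%:E.
  by rewrite lee_fin mulr_ge0.
have mJ : measurable_fun setT (fun y =>
    \int[mu]_x (`|\1_Om x - \1_Om y| * k x y)%:E).
  have := measurable_integral_section mu measurableT mj j0.
  apply: eq_measurable_fun => y _; apply: eq_integral => x _ /=.
  by rewrite distrC kC.
apply: (@le_trans _ _ (\int[mu]_(y in ~` Om) \int[mu]_x
    (`|\1_Om x - \1_Om y| * k x y)%:E)); last first.
  apply: ge0_subset_integral => // y _.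
  by apply: integral_ge0 => x _; exact: (j0 (x, y)).
apply: ge0_le_integral => //.
- by move=> x _; exact: potential_ge0.
- exact/measurable_funTS/measurable_potential.
- exact: measurable_funTS.
move=> y Oy.
apply: (@le_trans _ _ (\int[mu]_(x in Om) (`|\1_Om x - \1_Om y| * k x y)%:E)).
  rewrite le_eqVlt; apply/orP; left; apply/eqP.
  apply: eq_integral => x; rewrite inE => Ox.
  by rewrite kC !indicE mem_set// memNset// subr0 normr1 mul1r.
apply: ge0_subset_integral => //.
  exact: (measurableT_comp mj (pair2_measurable y)).
by move=> x _; exact: (j0 (x, y)).
Qed.

(* Points outside [Om] with infinite potential form a null set. *)
Lemma integral_potential_fin (f : T -> \bar R) :
  \int[mu]_(x in ~` Om) potential k Om x < +oo ->
  measurable_fun (~` Om) f -> (forall x, (~` Om) x -> 0 <= f x) ->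
  \int[mu]_(x in ~` Om) f x =
  \int[mu]_(x in ~` Om `&` [set x | potential k Om x < +oo]) f x.
Proof.
move=> perim mf f0.
have mOc : measurable (~` Om) by exact: measurableC.
have mP : measurable_fun (~` Om) (potential k Om).
  exact/measurable_funTS/measurable_potential.
pose N := ~` Om `&` [set x | potential k Om x = +oo].
have mN : measurable N.
  rewrite (_ : N = ~` Om `&` potential k Om @^-1` [set +oo])//.
  exact: mP.
have N0 : mu N = 0.
  apply/(negligibleP _ mN).
  have iP : mu.-integrable (~` Om) (potential k Om).
    apply/integrableP; split=> //.
    by under eq_integral do rewrite gee0_abs ?potential_ge0//.
  by apply: negligibleS (integrable_ae mOc iP) => x [Ox /= Px] /(_ Ox); rewrite Px.
rewrite (ge0_negligible_integral mN mOc mf f0 N0); congr integral.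
apply/seteqP; split=> x /= [Ox]; rewrite ltey => h; split=> //.
  by apply/eqP => Px; apply: h; split.
by move=> [_ Px]; move: h; rewrite Px eqxx.
Qed.

Lemma competitor_energy E : measurable E -> E `<=` Om ->
  \int[mu]_(x in ~` Om) potential k Om x < +oo ->
  nonlocal_energy k (competitor E) = limit_energy k E.
Proof.
move=> mE EO perim; have mc := measurable_competitor mE.
rewrite nonlocal_energy_split// /limit_energy; congr (_ * _ + _).
  apply: eq_integral => -[x y]; rewrite in_setX => /andP[/=].
  rewrite !inE => Ox Oy; rewrite !competitor_in// !indicE; congr (_ * _)%:E.
  by case: (x \in E); case: (y \in E);
    rewrite /= ?subrr ?normr0 ?expr0n// ?subr0 ?normr1 ?expr1n//
      sub0r sqrrN normrN normr1 expr1n.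
(* The pointwise identity is available only where the potential of [Om] is finite, so both integrals
   are restricted to such points. *)
rewrite integral_potential_fin//; last 2 first.
- apply: emeasurable_funD; last exact: measurable_boundary_term.
  apply: measurable_funTS.
  apply: (measurable_integral_section _ mOm (measurable_dirichlet mc)) => p.
  by rewrite lee_fin mulr_ge0// sqr_ge0.
- move=> x Ox; rewrite adde_ge0 ?boundary_term_ge0//.
  by apply: integral_ge0 => y _; rewrite lee_fin mulr_ge0// sqr_ge0.
rewrite [RHS]integral_potential_fin//; last 2 first.
- exact: measurable_exterior_density.
- by move=> x Ox; exact: exterior_density_ge0.
apply: eq_integral => x; rewrite inE => -[Ox Px].
rewrite -exterior_density_competitor//; congr (_ + _).
by apply: eq_integral => y; rewrite inE => Oy; rewrite (competitor_in E Oy).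
Qed.

End kernel.

(** * Lower bound of the energy by the limit functional of a smaller, bounded kernel *)

Section lower_bound.
Variables (k k' : T -> T -> R) (M : R) (B : set T).
Hypothesis mk : measurable_fun [set: T * T] (fun p => k p.1 p.2).
Hypothesis k_ge0 : forall x y, (0 <= k x y)%R.
Hypothesis kC : forall x y, k x y = k y x.
Hypothesis mk' : measurable_fun [set: T * T] (fun p => k' p.1 p.2).
Hypothesis k'_ge0 : forall x y, (0 <= k' x y)%R.
Hypothesis k'k : forall x y, (k' x y <= k x y)%R.
Hypothesis M_ge0 : (0 <= M)%R.
Hypothesis mB : measurable B.
Hypothesis k'M : forall x y, (k' x y <= M * \1_B x)%R.

Lemma potential_truncated_lty x : potential k' Om x < +oo.
Proof.
apply: (@le_lt_trans _ _ (\int[mu]_(y in Om) M%:E)).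
  apply: ge0_le_integral => //.
  - by move=> y _; rewrite lee_fin.
  - exact: measurable_kernel_section.
  - move=> y _; rewrite lee_fin (le_trans (k'M _ _))// indicE.
    by case: (x \in B) => /=; rewrite ?mulr1// mulr0.
by rewrite integral_cst// lte_mul_pinfty.
Qed.

Variables (v : T -> R) (E : set T).
Hypothesis mv : measurable_fun setT v.
Hypothesis v_ae : {ae mu, forall x, (~` Om) x -> b x = 0%R -> v x = 0%R}.
Hypothesis mE : measurable E.
Hypothesis EO : E `<=` Om.

Let I := (2 * M)%:E * \int[mu]_(y in Om) (`|v y - \1_E y|)%:E.

Let I_ge0 : 0 <= I.
Proof.
by rewrite /I mule_ge0 ?lee_fin ?mulr_ge0//; apply: integral_ge0 => y _; rewrite lee_fin.
Qed.

Let mdist : measurable_fun setT (fun y => (`|v y - \1_E y|)%:E).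
Proof.
apply/measurable_EFinP; apply: measurableT_comp => //.
exact: measurable_funB.
Qed.

Let integral_dist : \int[mu]_(y in Om) ((2 * M)%:E * (`|v y - \1_E y|)%:E) = I.
Proof.
rewrite ge0_integralZl//; first exact: measurable_funTS.
by rewrite lee_fin mulr_ge0.
Qed.

Let indic01 y : \1_E y = 0%R :> R \/ \1_E y = 1%R :> R.
Proof. by rewrite indicE; case: (y \in E); [right|left]. Qed.

Let k'M1 x y : (k' x y <= M)%R.
Proof.
rewrite (le_trans (k'M _ _))// indicE.
by case: (x \in B) => /=; rewrite ?mulr1// mulr0.
Qed.

(** [indic_approx] is multiplied by [k'], which is then bounded by [k] in the quadratic term and by
    [M] in the two error terms. *)
Lemma interior_energy_le :
  2^-1%:E * \int[mu \x mu]_(p in Om `*` Om)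
    (`|\1_E p.1 - \1_E p.2| * k' p.1 p.2)%:E <=
  2^-1%:E * \int[mu \x mu]_(p in Om `*` Om)
    ((v p.1 - v p.2) ^+ 2 * k p.1 p.2)%:E + I * mu Om.
Proof.
have mD := measurable_dirichlet mk mv.
have D0 p : 0 <= ((v p.1 - v p.2) ^+ 2 * k p.1 p.2)%:E.
  by rewrite lee_fin mulr_ge0// sqr_ge0.
have md1 : measurable_fun [set: T * T]
    (fun p => (2 * M)%:E * (`|v p.1 - \1_E p.1|)%:E).
  by apply: measurable_funeM; exact: (measurableT_comp mdist).
have md2 : measurable_fun [set: T * T]
    (fun p => (2 * M)%:E * (`|v p.2 - \1_E p.2|)%:E).
  by apply: measurable_funeM; exact: (measurableT_comp mdist).
have d0 y : 0 <= (2 * M)%:E * (`|v y - \1_E y|)%:E.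
  by rewrite mule_ge0// lee_fin mulr_ge0.
have mO2 : measurable (Om `*` Om) by exact: measurableX.
have mi : measurable_fun [set: T] (\1_E : T -> R) by [].
have mi1 : measurable_fun [set: T * T]
    (fun p => (`|\1_E p.1 - \1_E p.2| * k' p.1 p.2)%:E).
  apply/measurable_EFinP; apply: measurable_funM => //.
  apply: measurableT_comp => //; apply: measurable_funB.
    exact: (measurableT_comp mi).
  exact: (measurableT_comp mi).
apply: (@le_trans _ _ (2^-1%:E * \int[mu \x mu]_(p in Om `*` Om)
    (((v p.1 - v p.2) ^+ 2 * k p.1 p.2)%:E +
     ((2 * M)%:E * (`|v p.1 - \1_E p.1|)%:E +
      (2 * M)%:E * (`|v p.2 - \1_E p.2|)%:E)))).
  apply: lee_wpmul2l => //; apply: ge0_le_integral => //.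
  - by move=> p _; rewrite lee_fin mulr_ge0.
  - exact: measurable_funTS.
  - apply: measurable_funTS; apply: emeasurable_funD => //.
    exact: emeasurable_funD.
  - move=> [x y] _ /=; rewrite -!EFinM -!EFinD lee_fin.
    have h := @indic_approx R _ _ (v x) (v y) (indic01 x) (indic01 y).
    apply: (le_trans (ler_wpM2r (k'_ge0 x y) h)).
    have h1 := ler_wpM2l (sqr_ge0 (v x - v y)%R) (k'k x y).
    have h2 := ler_wpM2l (normr_ge0 (v x - \1_E x)%R) (k'M1 x y).
    have h3 := ler_wpM2l (normr_ge0 (v y - \1_E y)%R) (k'M1 x y).
    lra.
rewrite ge0_integralD//; last 3 first.
- exact: measurable_funTS.
- by move=> p _; rewrite adde_ge0.
- by apply: measurable_funTS; exact: emeasurable_funD.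
rewrite ge0_integralD//; last 2 first.
- exact: measurable_funTS.
- exact: measurable_funTS.
(* Each error term depends on one coordinate; Tonelli is applied in the order that integrates this
   coordinate first, so the inner integral is [I]. *)
rewrite (integral_setX_swap mu mOm mOm md1)// (integral_setX mu mOm mOm md2)//=.
rewrite integral_dist integral_cst// ge0_muleDr; last 2 first.
- exact: integral_ge0.
- by rewrite adde_ge0// mule_ge0.
rewrite leeD2l// -[X in X + X]mul1e -ge0_muleDl// muleA -EFinD -EFinM mulVf//.
by rewrite mul1e.
Qed.

(** The minimization for [k'] is applied at the clamped value of [v x]: clamping preserves the value
    0 prescribed where [b] vanishes, does not increase the boundary term and makes the error linear.
    At [x] the error is at most [I], and it vanishes off [B], where [k'] does. The comparison is
    almost everywhere, like the constraint on [v]. *)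
Lemma exterior_energy_le :
  \int[mu]_(x in ~` Om) exterior_density k' E x <=
  \int[mu]_(x in ~` Om)
      (\int[mu]_(y in Om) ((v x - v y) ^+ 2 * k x y)%:E
       + potential k Om x * (a x / b x * v x ^+ 2)%:E)
  + I * mu B.
Proof.
have mOc : measurable (~` Om) by exact: measurableC.
have mD := measurable_dirichlet mk mv.
have D0 p : 0 <= ((v p.1 - v p.2) ^+ 2 * k p.1 p.2)%:E.
  by rewrite lee_fin mulr_ge0// sqr_ge0.
have msec x : measurable_fun Om (fun y => ((v x - v y) ^+ 2 * k x y)%:E).
  apply: measurable_funTS.
  exact: (measurableT_comp mD (pair1_measurable x)).
have mG : measurable_fun (~` Om) (fun x =>
    \int[mu]_(y in Om) ((v x - v y) ^+ 2 * k x y)%:E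
       + potential k Om x * (a x / b x * v x ^+ 2)%:E).
  apply: emeasurable_funD; last exact: measurable_boundary_term.
  by apply: measurable_funTS; exact: (measurable_integral_section _ mOm mD D0).
have G0 x : (~` Om) x -> 0 <= \int[mu]_(y in Om) ((v x - v y) ^+ 2 * k x y)%:E
       + potential k Om x * (a x / b x * v x ^+ 2)%:E.
  move=> Ox; rewrite adde_ge0 ?boundary_term_ge0//.
  by apply: integral_ge0 => y _; exact: (D0 (x, y)).
have mBI : measurable_fun setT (fun x => I * (\1_B x)%:E).
  by apply: measurable_funeM; apply/measurable_EFinP.
have BI0 x : 0 <= I * (\1_B x)%:E by rewrite mule_ge0.
apply: (@le_trans _ _ (\int[mu]_(x in ~` Om)
      ((\int[mu]_(y in Om) ((v x - v y) ^+ 2 * k x y)%:E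
       + potential k Om x * (a x / b x * v x ^+ 2)%:E) + I * (\1_B x)%:E))); last first.
  rewrite ge0_integralD//; last exact: measurable_funTS.
  rewrite leeD2l// ge0_integralZl//; last first.
    by apply: measurable_funTS; apply/measurable_EFinP.
  rewrite lee_wpmul2l// integral_indic//.
  by apply: le_measure; rewrite ?inE//; exact: measurableI.
apply: ae_ge0_le_integral => //.
- by move=> x Ox; exact: exterior_density_ge0.
- exact: measurable_exterior_density.
- by move=> x Ox; rewrite adde_ge0// G0.
- by apply: emeasurable_funD => //; exact: measurable_funTS.
apply: filterS v_ae => x bv Ox.
have bt : b x = 0%R -> clamp01 (v x) = 0%R.
  move=> /(bv Ox) ->; rewrite /clamp01 maxxx; apply/min_idPl; exact: ler01.
have := exterior_density_le mk' k'_ge0 mE EO (potential_truncated_lty x) Ox bt.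
move=> /le_trans; apply; rewrite [leRHS]addeAC; apply: leeD.
  rewrite -integral_dist [X in _ <= _ + X]muleC -ge0_integralZl//; last 2 first.
  - by apply: measurable_funTS; exact: measurable_funeM.
  - by move=> y _; rewrite mule_ge0// lee_fin mulr_ge0.
  rewrite -ge0_integralD//; last 3 first.
  - by move=> y _; exact: (D0 (x, y)).
  - by move=> y _; rewrite !mule_ge0// lee_fin mulr_ge0.
  - by apply: measurable_funTS; apply: measurable_funeM; exact: measurable_funeM.
  apply: ge0_le_integral => //.
  - by move=> y _; rewrite lee_fin mulr_ge0// sqr_ge0.
  - apply/measurable_EFinP; apply: measurable_funM.
      by apply: measurable_funX; apply: measurable_funB => //; exact: measurable_funTS.
    exact/measurable_EFinP/measurable_kernel_section.
  - apply: emeasurable_funD => //; apply: measurable_funTS.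
    by apply: measurable_funeM; exact: measurable_funeM.
  move=> y _; rewrite -!EFinM -!EFinD lee_fin.
  have h := @clamp01_approx R (v x) _ (v y) (indic01 y).
  apply: (le_trans (ler_wpM2r (k'_ge0 x y) h)).
  have h1 := ler_wpM2l (sqr_ge0 (v x - v y)%R) (k'k x y).
  have h2 := ler_wpM2l (normr_ge0 (v y - \1_E y)%R) (k'M x y).
  lra.
apply: lee_pmul.
- exact: potential_ge0.
- by rewrite lee_fin mulr_ge0 ?sqr_ge0// divr_ge0 ?a_ge0 ?b_ge0.
- apply: ge0_le_integral => //.
  + by move=> y _; rewrite lee_fin.
  + exact: measurable_kernel_section.
  + exact: measurable_kernel_section.
  + by move=> y _; rewrite lee_fin.
- rewrite lee_fin ler_wpM2l ?clamp01_sqr//.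
  by rewrite divr_ge0 ?a_ge0 ?b_ge0.
Qed.

Lemma limit_energy_le :
  limit_energy k' E <= nonlocal_energy k v
    + (2 * M)%:E * \int[mu]_(y in Om) (`|v y - \1_E y|)%:E * (mu Om + mu B).
Proof.
rewrite nonlocal_energy_split// -[X in _ + X]/(I * (mu Om + mu B)).
rewrite (ge0_muleDr _ (measure_ge0 _ _) (measure_ge0 _ _)) addeACA.
exact: leeD interior_energy_le exterior_energy_le.
Qed.

End lower_bound.

(** * Truncated kernels and monotone convergence of their limit functionals *)

Section truncation.
Variables (k : T -> T -> R) (B : nat -> set T).
Hypothesis mk : measurable_fun [set: T * T] (fun p => k p.1 p.2).
Hypothesis k_ge0 : forall x y, (0 <= k x y)%R.
Hypothesis mB : forall m, measurable (B m).
Hypothesis ndB : {homo B : m p / (m <= p)%N >-> m `<=` p}.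
Hypothesis bigcupB : \bigcup_m B m = setT.

(** Only the first variable is cut off, because for subsets of [Om] the second one stays in [Om] in
    [limit_energy]. Symmetry is lost, but [limit_energy_le] asks it of the full kernel only. *)
Definition truncation (m : nat) x y : R := (Num.min (k x y) m%:R * \1_(B m) x)%R.

Lemma truncation_ge0 m x y : (0 <= truncation m x y)%R.
Proof. by rewrite mulr_ge0// le_min k_ge0 ler0n. Qed.

Lemma measurable_truncation m :
  measurable_fun [set: T * T] (fun p => truncation m p.1 p.2).
Proof.
have mi : measurable_fun [set: T] (\1_(B m) : T -> R) by [].
apply: measurable_funM; last exact: (measurableT_comp mi).
exact: measurable_minr.
Qed.

Lemma truncation_le m x y : (truncation m x y <= k x y)%R.
Proof.
rewrite /truncation indicE; case: (x \in B m); last by rewrite mulr0.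
by rewrite mulr1 ge_min lexx.
Qed.

Lemma truncation_bound m x y : (truncation m x y <= m%:R * \1_(B m) x)%R.
Proof. by rewrite ler_wpM2r// ge_min lexx orbT. Qed.

Lemma le_truncation m p x y : (m <= p)%N ->
  (truncation m x y <= truncation p x y)%R.
Proof.
move=> mp; rewrite /truncation; apply: ler_pM => //.
- by rewrite le_min k_ge0 ler0n.
- by rewrite le_min !ge_min lexx/= ler_nat mp orbT.
rewrite !indicE; case: (boolP (x \in B m)) => //=.
by rewrite inE => /(ndB mp) xp; rewrite mem_set.
Qed.

Lemma truncation_near x y : \forall m \near \oo, truncation m x y = k x y.
Proof.
have : (\bigcup_m B m) x by rewrite bigcupB.
move=> [N _ BN]; exists (maxn N (Num.truncn (k x y)).+1) => // m /=.
rewrite geq_max => /andP[Nm km].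
rewrite /truncation indicE mem_set ?mulr1; last exact: ndB BN.
apply/min_idPl; apply/ltW; apply: lt_le_trans (truncnS_gt _) _.
by rewrite ler_nat.
Qed.

Lemma cvg_potential_truncation F x : measurable F ->
  potential (truncation m) F x @[m --> \oo] --> potential k F x.
Proof.
move=> mF; apply: cvg_ge0_integral => //.
- by move=> m; apply: measurable_kernel_section; exact: measurable_truncation.
- by move=> m y _; rewrite lee_fin truncation_ge0.
- by move=> y _ m p mp; rewrite lee_fin le_truncation.
- move=> y _; apply: cvg_near_cst; have := truncation_near x y.
  by apply: filterS => m ->.
Qed.

Lemma le_potential_truncation F x : measurable F ->
  {homo (fun m => potential (truncation m) F x) : m p / (m <= p)%N >-> m <= p}.
Proof.
move=> mF m p mp; apply: ge0_le_integral => //.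
- by move=> y _; rewrite lee_fin truncation_ge0.
- by apply: measurable_kernel_section; exact: measurable_truncation.
- by apply: measurable_kernel_section; exact: measurable_truncation.
- by move=> y _; rewrite lee_fin le_truncation.
Qed.

Lemma potential_truncation_le F x m : measurable F ->
  potential (truncation m) F x <= potential k F x.
Proof.
move=> mF; apply: ge0_le_integral => //.
- by move=> y _; rewrite lee_fin truncation_ge0.
- by apply: measurable_kernel_section; exact: measurable_truncation.
- exact: measurable_kernel_section.
- by move=> y _; rewrite lee_fin truncation_le.
Qed.

(** The interior term is plain monotone convergence. The exterior density contains a quotient of
    potentials, so its monotonicity and its limit come from [le_exterior_mix] and
    [cvg_exterior_mix], on the points of finite potential; the remaining points are null by
    [perim]. *)
Lemma cvg_limit_energy E : measurable E -> E `<=` Om ->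
  \int[mu]_(x in ~` Om) potential k Om x < +oo ->
  limit_energy (truncation m) E @[m --> \oo] --> limit_energy k E.
Proof.
move=> mE EO perim.
have mEc : measurable (~` E `&` Om).
  by apply: measurableI => //; exact: measurableC.
have mOc : measurable (~` Om) by exact: measurableC.
have mi : measurable_fun [set: T] (\1_E : T -> R) by [].
have mP : measurable_fun (~` Om) (potential k Om).
  exact/measurable_funTS/measurable_potential.
apply: cvgeD.
- apply: ge0_adde_def; rewrite inE.
    by rewrite mule_ge0//; apply: integral_ge0 => p _; rewrite lee_fin mulr_ge0.
  by apply: integral_ge0 => x Ox; exact: exterior_density_ge0.
- apply: cvgeZl => //; apply: cvg_ge0_integral.
  + exact: measurableX.
  + move=> m; apply: measurable_funTS; apply/measurable_EFinP.
    apply: measurable_funM; last exact: measurable_truncation.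
    apply: measurableT_comp => //; apply: measurable_funB.
      exact: (measurableT_comp mi).
    exact: (measurableT_comp mi).
  + by move=> m p _; rewrite lee_fin mulr_ge0// truncation_ge0.
  + by move=> p _ m q mq; rewrite lee_fin ler_wpM2l// le_truncation.
  + move=> [x y] _; apply: cvg_near_cst; have := truncation_near x y.
    by apply: filterS => m /= ->.
have mdens m : measurable_fun (~` Om) (exterior_density (truncation m) E).
  apply: measurable_exterior_density => //; first exact: measurable_truncation.
  exact: truncation_ge0.
have dens0 m x : (~` Om) x -> 0 <= exterior_density (truncation m) E x.
  by move=> Ox; apply: exterior_density_ge0 => //; exact: truncation_ge0.
rewrite (integral_potential_fin mk k_ge0 perim); last 2 first.
- exact: measurable_exterior_density.
- by move=> x Ox; exact: exterior_density_ge0.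
rewrite (_ : (fun m => _) = fun m =>
    \int[mu]_(x in ~` Om `&` [set x | potential k Om x < +oo])
      exterior_density (truncation m) E x); last first.
  apply/funext => m.
  exact: (integral_potential_fin mk k_ge0 perim (mdens m) (dens0 m)).
have tfin m x : potential k Om x < +oo -> potential (truncation m) Om x < +oo.
  by apply: le_lt_trans; exact: potential_truncation_le.
have tE m x : potential k Om x < +oo -> exterior_density (truncation m) E x =
    (exterior_mix (a x) (b x) (fine (potential (truncation m) E x))
                 (fine (potential (truncation m) (~` E `&` Om) x)))%:E.
  move=> Px; apply: exterior_densityE => //; last exact: tfin.
    exact: measurable_truncation.
  exact: truncation_ge0.
have pf F m x : measurable F -> F `<=` Om -> potential k Om x < +oo ->
    potential (truncation m) F x \is a fin_num.
  move=> mF FO Px; apply: potential_fin_numW => //; last exact: tfin.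
    exact: measurable_truncation.
  exact: truncation_ge0.
have pk F x : measurable F -> F `<=` Om -> potential k Om x < +oo ->
    potential k F x \is a fin_num.
  by move=> mF FO Px; exact: potential_fin_numW.
have EcO : ~` E `&` Om `<=` Om by move=> ? [].
apply: cvg_ge0_integral.
- exact: emeasurable_fun_infty_o.
- move=> m; apply: (@measurable_funS _ _ _ _ (~` Om)) => //.
- by move=> m x [Ox _]; exact: dens0.
- move=> x [Ox Px] m p mp; rewrite !tE// lee_fin.
  apply: le_exterior_mix; rewrite ?a_ge0 ?b_ge0//.
  + by apply: fine_ge0; apply: potential_ge0; exact: truncation_ge0.
  + by apply: fine_ge0; apply: potential_ge0; exact: truncation_ge0.
  + by apply: fine_le; rewrite ?pf//; exact: le_potential_truncation.
  + by apply: fine_le; rewrite ?pf//; exact: le_potential_truncation.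
move=> x [Ox Px]; rewrite exterior_densityE//.
under eq_fun => m do rewrite tE//.
apply/cvg_EFin; first by near=> m.
have bnd F m : measurable F -> F `<=` Om ->
    (0 <= fine (potential (truncation m) F x) <= fine (potential k F x))%R.
  move=> mF FO; rewrite fine_ge0/=; last by apply: potential_ge0; exact: truncation_ge0.
  by apply: fine_le; rewrite ?pf ?pk//; exact: potential_truncation_le.
have fc F : measurable F -> F `<=` Om ->
    fine (potential (truncation m) F x) @[m --> \oo] --> fine (potential k F x).
  move=> mF FO; apply: fine_cvg; rewrite fineK ?pk//.
  exact: cvg_potential_truncation.
apply: cvg_exterior_mix.
- by move=> m; exact: bnd.
- by move=> m; exact: bnd.
- exact: fc.
- exact: fc.
Unshelve. all: by end_near.
Qed.

End truncation.

(** * The weak equation: energy identity and comparison with a test function *)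

Section weak_solution.
Variable k : T -> T -> R.
Hypothesis mk : measurable_fun [set: T * T] (fun p => k p.1 p.2).
Hypothesis k_ge0 : forall x y, (0 <= k x y)%R.

Definition energy_form u v : \bar R :=
  2^-1%:E * \int[mu \x mu]_(p in ~` (~` Om `*` ~` Om))
    ((u p.1 - u p.2) * (v p.1 - v p.2) * k p.1 p.2)%:E
  + \int[mu]_(x in ~` Om `&` [set x | (0 < b x)%R])
      (potential k Om x * (a x / b x * u x * v x)%:E).

(* Where [b] vanishes the integrand is 0, because [a x / 0 = 0]. *)
Lemma integral_boundary_gt0 (f : T -> R) :
  \int[mu]_(x in ~` Om `&` [set x | (0 < b x)%R])
    (potential k Om x * (a x / b x * f x)%:E) =
  \int[mu]_(x in ~` Om) (potential k Om x * (a x / b x * f x)%:E).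
Proof.
rewrite integral_mkcond [RHS]integral_mkcond; apply: eq_integral => x _.
rewrite !patchE in_setI; case: ifPn => [/andP[-> //]|].
case: (boolP (x \in ~` Om)) => //=; rewrite inE => Ox.
rewrite notin_setE /= => b0.
have -> : b x = 0%R by have := b_ge0 Ox; move/negP: b0; rewrite -leNgt; lra.
by rewrite invr0 mulr0 mul0r mule0.
Qed.

Lemma energy_form_self v : energy_form v v = nonlocal_energy k v.
Proof.
rewrite /energy_form /nonlocal_energy -(integral_boundary_gt0 (fun x => v x ^+ 2)%R).
by congr (_ + _); apply: eq_integral => x _; rewrite expr2 mulrA.
Qed.

Lemma energy_form_le u v : measurable_fun setT u -> measurable_fun setT v ->
  energy_form u v <= 2^-1%:E * (nonlocal_energy k u + nonlocal_energy k v).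
Proof.
move=> mu' mv.
have mOc : measurable (~` Om) by exact: measurableC.
have moff : measurable (~` (~` Om `*` ~` Om)).
  by apply: measurableC; exact: measurableX.
have D0 w p : 0 <= ((w p.1 - w p.2) ^+ 2 * k p.1 p.2)%:E.
  by rewrite lee_fin mulr_ge0// sqr_ge0.
have I0 w : 0 <= \int[mu \x mu]_(p in ~` (~` Om `*` ~` Om))
    ((w p.1 - w p.2) ^+ 2 * k p.1 p.2)%:E by exact: integral_ge0.
have B0 w : 0 <= \int[mu]_(x in ~` Om) (potential k Om x * (a x / b x * w x ^+ 2)%:E).
  by apply: integral_ge0 => x Ox; exact: boundary_term_ge0.
rewrite /nonlocal_energy addeACA -(ge0_muleDr _ (I0 u) (I0 v)).
have h1 : 0 <= 2^-1%:E * (\int[mu \x mu]_(p in ~` (~` Om `*` ~` Om))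
      ((u p.1 - u p.2) ^+ 2 * k p.1 p.2)%:E +
    \int[mu \x mu]_(p in ~` (~` Om `*` ~` Om))
      ((v p.1 - v p.2) ^+ 2 * k p.1 p.2)%:E).
  by rewrite mule_ge0// adde_ge0.
rewrite [leRHS](ge0_muleDr _ h1 (adde_ge0 (B0 u) (B0 v))).
rewrite /energy_form; apply: leeD.
  apply: lee_wpmul2l => //; apply: integral_young => //.
  - by apply: measurable_funTS; exact: measurable_dirichlet.
  - by apply: measurable_funTS; exact: measurable_dirichlet.
  - apply: measurable_funTS; apply/measurable_EFinP; apply: measurable_funM => //.
    by apply: measurable_funM; apply: measurable_funB; exact: measurableT_comp.
  - move=> [x y] _ /=; rewrite -EFinD -EFinM lee_fin -mulrDl mulrA ler_wpM2r//.
    by have := sqr_ge0 ((u x - u y) - (v x - v y)); lra.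
rewrite (eq_integral (fun x =>
    potential k Om x * (a x / b x * (u x * v x))%:E)); last first.
  by move=> x _; rewrite -mulrA.
rewrite (integral_boundary_gt0 (fun x => u x * v x)%R).
apply: integral_young => //.
- exact: measurable_boundary_term.
- exact: measurable_boundary_term.
- apply: emeasurable_funM; first exact/measurable_funTS/measurable_potential.
  apply/measurable_EFinP; apply: measurable_funM.
    by apply: measurable_funM => //; exact: measurable_funV_ge0.
  by apply: measurable_funTS; exact: measurable_funM.
- by move=> x Ox; exact: boundary_term_ge0.
- by move=> x Ox; exact: boundary_term_ge0.
move=> x Ox.
have ab0 : (0 <= a x / b x)%R by rewrite divr_ge0 ?a_ge0 ?b_ge0.
have hw (w : R) : 0 <= (a x / b x * w ^+ 2)%:E.
  by rewrite lee_fin mulr_ge0// sqr_ge0.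
rewrite -(ge0_muleDr _ (hw (u x)) (hw (v x))) muleCA.
apply: lee_wpmul2l; first exact: potential_ge0.
have huv : (u x * v x <= 2^-1 * (u x ^+ 2 + v x ^+ 2))%R.
  by have := sqr_ge0 (u x - v x)%R; lra.
by rewrite -EFinD -EFinM lee_fin; have := ler_wpM2l ab0 huv; lra.
Qed.

Variables (phi : T -> R) (e : R) (E : set T).
Hypothesis mphi : measurable_fun setT phi.
Hypothesis e_ge0 : (0 <= e)%R.
Hypothesis mE : measurable E.
Hypothesis EO : E `<=` Om.
Hypothesis phi_L2 : \int[mu]_(x in Om) (phi x ^+ 2)%:E < +oo.
Hypothesis phi_energy : nonlocal_energy k phi < +oo.

(** One dominating function serves all integrands below; it is integrable because [Om] has finite
    measure and [phi] is square integrable on it. *)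
Let dominated (h : T -> R) : measurable_fun setT h ->
  (forall x, `|h x| <= 2 + 2 * phi x ^+ 2)%R ->
  mu.-integrable Om (EFin \o h).
Proof.
move=> mh hb.
have i1 : mu.-integrable Om (EFin \o (fun=> 2%R : R)).
  apply/integrableP; split; first exact: measurable_cst.
  by rewrite /= integral_cst//= normr_nat lte_mul_pinfty.
have i2 : mu.-integrable Om (EFin \o (fun x => phi x ^+ 2)%R).
  apply/integrableP; split.
    by apply/measurable_EFinP/measurable_funX; exact: measurable_funTS.
  by under eq_integral do rewrite /= ger0_norm ?sqr_ge0//.
have i3 : mu.-integrable Om (fun x => 2%:E + 2%:E * (phi x ^+ 2)%:E).
  by apply: integrableD => //; exact: integrableZl.
apply: (le_integrable mOm _ _ i3).
  by apply/measurable_EFinP; exact: measurable_funTS.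
move=> x _ /=; rewrite lee_fin (le_trans (hb x))//.
exact: ler_norm.
Qed.

Let indic01 y : \1_E y = 0%R :> R \/ \1_E y = 1%R :> R.
Proof. by rewrite indicE; case: (y \in E); [right|left]. Qed.

Let mi : measurable_fun [set: T] (\1_E : T -> R).
Proof. by []. Qed.

Let i_sq : mu.-integrable Om (fun x => (phi x ^+ 2)%:E).
Proof.
apply: dominated; first exact: measurable_funX.
by move=> x; have s0 := sqr_ge0 (phi x); rewrite ger0_norm//; lra.
Qed.

Let i_dist : mu.-integrable Om (fun x => ((phi x - \1_E x) ^+ 2)%:E).
Proof.
apply: dominated; first by apply: measurable_funX; exact: measurable_funB.
move=> x; rewrite ger0_norm ?sqr_ge0//.
have s0 := sqr_ge0 (phi x); have s1 := sqr_ge0 (phi x + 1).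
by case: (indic01 x) => ->; lra.
Qed.

Let i_gap : mu.-integrable Om (fun x => (\1_E x * (1 - phi x))%:E).
Proof.
apply: dominated; first by apply: measurable_funM => //; exact: measurable_funB.
move=> x; have s0 := sqr_ge0 (phi x); have s1 := sqr_ge0 (phi x + 1).
have s2 := sqr_ge0 (phi x - 1).
by rewrite ler_norml; apply/andP; split; case: (indic01 x) => ->; lra.
Qed.

Let i_prod : mu.-integrable Om (fun x => (\1_E x * phi x)%:E).
Proof.
apply: dominated; first exact: measurable_funM.
move=> x; have s0 := sqr_ge0 (phi x); have s1 := sqr_ge0 (phi x + 1).
have s2 := sqr_ge0 (phi x - 1).
by rewrite ler_norml; apply/andP; split; case: (indic01 x) => ->; lra.
Qed.

Hypothesis weak_self :
  \int[mu]_(x in Om) (phi x * phi x)%:E + e%:E * energy_form phi phi =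
  \int[mu]_(x in Om) (\1_E x * phi x)%:E.

Let energy_ge0 v : 0 <= nonlocal_energy k v.
Proof.
rewrite adde_ge0//.
  by rewrite mule_ge0//; apply: integral_ge0 => p _; rewrite lee_fin mulr_ge0// sqr_ge0.
by apply: integral_ge0 => x Ox; exact: boundary_term_ge0.
Qed.

(** Since an indicator equals its square, [chi (1 - phi) + phi^2 = (phi - chi)^2 + chi phi]
    pointwise. The weak equation tested with [phi] itself evaluates the difference of the integrals
    of [chi phi] and [phi^2]. *)
Lemma solution_energy_identity :
  \int[mu]_(x in Om) (\1_E x * (1 - phi x))%:E =
  \int[mu]_(x in Om) ((phi x - \1_E x) ^+ 2)%:E + e%:E * nonlocal_energy k phi.
Proof.
have eqD : \int[mu]_(x in Om) (\1_E x * (1 - phi x))%:E +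
    \int[mu]_(x in Om) (phi x ^+ 2)%:E =
    \int[mu]_(x in Om) ((phi x - \1_E x) ^+ 2)%:E +
    \int[mu]_(x in Om) (\1_E x * phi x)%:E.
  rewrite -!integralD//; apply: eq_integral => x _; rewrite -!EFinD.
  by congr EFin; case: (indic01 x) => ->; ring.
move: weak_self eqD; rewrite energy_form_self.
under eq_integral do rewrite -expr2.
(* All five quantities are finite, so the two equations can be subtracted as real ones. *)
have /fineK <- := integrable_fin_num mOm i_sq.
have /fineK <- := integrable_fin_num mOm i_dist.
have /fineK <- := integrable_fin_num mOm i_gap.
have /fineK <- := integrable_fin_num mOm i_prod.
have /fineK <- : nonlocal_energy k phi \is a fin_num by rewrite ge0_fin_numE.
rewrite -!EFinM -!EFinD => -[h1] [h2]; congr EFin; lra.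
Qed.

(** As [v] is the indicator of [E] on [Om], the weak equation reduces to: the left side equals [e]
    times the mixed energy of [phi] and [v]. That is at most half of [e Q(phi) + e Q(v)], and
    [e Q(phi)] is at most the left side by the energy identity, hence can be absorbed. *)
Lemma solution_energy_le v : measurable_fun setT v ->
  (forall x, Om x -> v x = \1_E x) -> nonlocal_energy k v < +oo ->
  \int[mu]_(x in Om) (phi x * v x)%:E + e%:E * energy_form phi v =
  \int[mu]_(x in Om) (\1_E x * v x)%:E ->
  \int[mu]_(x in Om) (\1_E x * (1 - phi x))%:E <= e%:E * nonlocal_energy k v.
Proof.
move=> mv vE vfin weak.
have gapE : \int[mu]_(x in Om) (\1_E x * (1 - phi x))%:E =
    e%:E * energy_form phi v.
  have eqD : \int[mu]_(x in Om) (\1_E x * (1 - phi x))%:E +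
      \int[mu]_(x in Om) (phi x * v x)%:E = \int[mu]_(x in Om) (\1_E x * v x)%:E.
    have -> : \int[mu]_(x in Om) (phi x * v x)%:E =
        \int[mu]_(x in Om) (\1_E x * phi x)%:E.
      by apply: eq_integral => x; rewrite inE => Ox; rewrite vE// mulrC.
    rewrite -integralD//; apply: eq_integral => x; rewrite inE => Ox.
    by rewrite vE// -EFinD; congr EFin; case: (indic01 x) => ->; ring.
  have fin : \int[mu]_(x in Om) (phi x * v x)%:E \is a fin_num.
    rewrite (_ : integral _ _ _ = \int[mu]_(x in Om) (\1_E x * phi x)%:E).
      exact: integrable_fin_num.
    by apply: eq_integral => x; rewrite inE => Ox; rewrite vE// mulrC.
  rewrite -[LHS](addeK _ fin) eqD -weak [X in X - _]addeC.
  exact: addeK.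
have h1 : \int[mu]_(x in Om) (\1_E x * (1 - phi x))%:E <=
    e%:E * (2^-1%:E * (nonlocal_energy k phi + nonlocal_energy k v)).
  by rewrite gapE lee_wpmul2l ?lee_fin// energy_form_le.
have h2 : e%:E * nonlocal_energy k phi <= \int[mu]_(x in Om) (\1_E x * (1 - phi x))%:E.
  rewrite solution_energy_identity leeDr//.
  by apply: integral_ge0 => x _; rewrite lee_fin sqr_ge0.
move: h1 h2; have /fineK <- := integrable_fin_num mOm i_gap.
have /fineK <- : nonlocal_energy k phi \is a fin_num by rewrite ge0_fin_numE.
have /fineK <- : nonlocal_energy k v \is a fin_num by rewrite ge0_fin_numE.
by rewrite -!EFinD -!EFinM !lee_fin; lra.
Qed.

End weak_solution.

End nonlocal_energy.

(** * The fractional kernel *)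

Section fractional_energy.
Context {R : realType} {n : nat}.
Variable s : R.
Variables (Omega : set 'rV[R]_n) (alpha beta : 'rV[R]_n -> R).
Hypothesis Omega_open : open Omega.
Hypothesis Omega_bounded : bounded_set Omega.
Hypothesis Omega_perimeter : (P_s s Omega < +oo)%E.
Hypothesis alpha_meas : measurable_fun (~` Omega) alpha.
Hypothesis beta_meas : measurable_fun (~` Omega) beta.
Hypothesis alpha_ge0 : forall x, (~` Omega) x -> 0 <= alpha x.
Hypothesis beta_ge0 : forall x, (~` Omega) x -> 0 <= beta x.
Hypothesis alpha_beta_gt0 : forall x, (~` Omega) x -> 0 < alpha x + beta x.
Local Notation mu := (@lebesgue_rV R n).
Local Notation k := (@frac_kernel R n s).
Local Notation energy := (nonlocal_energy mu Omega alpha beta k).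
Local Notation potential := (potential mu k).
Implicit Types (v : 'rV[R]_n -> R) (E : set 'rV[R]_n).
Local Open Scope ereal_scope.

Let mOmega : measurable Omega.
Proof. exact: open_measurable_rV. Qed.

Let Omega_fin : mu Omega < +oo.
Proof. exact: bounded_lebesgue_fin. Qed.

Let mk : measurable_fun [set: 'rV[R]_n * 'rV[R]_n] (fun p => k p.1 p.2).
Proof. exact: measurable_frac_kernel. Qed.

Let k_ge0 x y : (0 <= k x y)%R.
Proof. exact: frac_kernel_ge0. Qed.

Let kC x y : k x y = k y x.
Proof. exact: frac_kernelC. Qed.

Let m_jump E : measurable E ->
  measurable_fun [set: 'rV[R]_n * 'rV[R]_n]
    (fun p => (`|\1_E p.1 - \1_E p.2| * k p.1 p.2)%:E).
Proof.
move=> mE; have mi : measurable_fun [set: 'rV[R]_n] (\1_E : _ -> R) by [].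
apply/measurable_EFinP; apply: measurable_funM => //.
apply: measurableT_comp => //; apply: measurable_funB.
  exact: (measurableT_comp mi).
exact: (measurableT_comp mi).
Qed.

Let jump_ge0 E (p : 'rV[R]_n * 'rV[R]_n) :
  0 <= (`|\1_E p.1 - \1_E p.2| * k p.1 p.2)%:E.
Proof. by rewrite lee_fin mulr_ge0. Qed.

Lemma exterior_potential_lty : \int[mu]_(x in ~` Omega) potential Omega x < +oo.
Proof.
have jfin : \int[mu]_y \int[mu]_x (`|\1_Omega x - \1_Omega y| * k x y)%:E < +oo.
  by move: Omega_perimeter; apply: lty_pmull; rewrite invr_gt0.
exact: le_lt_trans (integral_exterior_potential_le mu mOmega mk k_ge0 kC) jfin.
Qed.

Lemma J_0E E : measurable_subset Omega E ->
  J_0 s Omega alpha beta E =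
  (c_ns (n := n) s)%:E * limit_energy mu Omega alpha beta k E.
Proof.
move=> [mE EO]; rewrite /J_0 /limit_energy; congr (_ * _).
rewrite -addeA; congr (_ + _).
  rewrite /P_sL; congr (_ * _).
  by rewrite (integral_setX_swap mu mOmega mOmega (m_jump mE) (jump_ge0 E)).
exact/esym/(integral_exterior_density mu mOmega alpha_meas beta_meas
  alpha_ge0 beta_ge0 alpha_beta_gt0 mk k_ge0 mE EO).
Qed.

Let integral_off v :
  \int[mu \x mu]_(p in off_exterior Omega)
    (`|v p.1 - v p.2| ^+ 2 * k p.1 p.2)%:E =
  \int[mu \x mu]_(p in ~` (~` Omega `*` ~` Omega))
    ((v p.1 - v p.2) ^+ 2 * k p.1 p.2)%:E.
Proof.
by apply: eq_integral => p _; rewrite real_normK// num_real.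
Qed.

Let integral_off_ge0 v : 0 <= \int[mu \x mu]_(p in ~` (~` Omega `*` ~` Omega))
    ((v p.1 - v p.2) ^+ 2 * k p.1 p.2)%:E.
Proof. by apply: integral_ge0 => p _; rewrite lee_fin mulr_ge0// sqr_ge0. Qed.

Let integral_boundary_ge0 v :
  0 <= \int[mu]_(x in ~` Omega) (potential Omega x * (alpha x / beta x * v x ^+ 2)%:E).
Proof.
apply: integral_ge0 => x Ox; rewrite mule_ge0 ?potential_ge0//.
by rewrite lee_fin mulr_ge0 ?sqr_ge0// divr_ge0 ?alpha_ge0 ?beta_ge0.
Qed.

Lemma in_WP v : in_W s Omega alpha beta v <->
  [/\ measurable_fun [set: 'rV[R]_n] v,
      {ae mu, forall x, (~` Omega) x -> beta x = 0%R -> v x = 0%R},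
      \int[mu]_(x in Omega) (v x ^+ 2)%:E < +oo & energy v < +oo].
Proof.
rewrite /in_W integral_off /nonlocal_energy.
rewrite (@integral_boundary_gt0 _ _ _ mu Omega alpha beta beta_ge0 k
  (fun x => v x ^+ 2)%R).
have := integral_off_ge0 v; have := integral_boundary_ge0 v.
have : 0 <= \int[mu]_(x in Omega) (v x ^+ 2)%:E.
  by apply: integral_ge0 => x _; rewrite lee_fin sqr_ge0.
set X := integral _ Omega _; set Y := integral _ (~` (_ `*` _)) _.
set Z := integral _ (~` Omega) _ => X0 Z0 Y0.
clearbody X Y Z.
split=> [[mv vae XYZ]|[mv vae Xoo YZ]]; split=> //.
- by apply: le_lt_trans XYZ; rewrite -addeA leeDl// adde_ge0.
- have YZ : Y + Z < +oo.
    by apply: le_lt_trans XYZ; rewrite -addeA leeDr.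
  apply: le_lt_trans YZ; rewrite leeD2r//.
  by rewrite -[leRHS]mul1e lee_wpmul2r// lee_fin invf_le1// ler1n.
- have Zoo : Z < +oo by apply: le_lt_trans YZ; rewrite leeDr// mule_ge0.
  have Yoo : 2^-1%:E * Y < +oo by apply: le_lt_trans YZ; rewrite leeDl.
  rewrite !lte_add_pinfty//.
  by move: Yoo; apply: lty_pmull; rewrite invr_gt0.
Qed.

(** * Bounds on the functionals and passage to the limit *)

Hypothesis s_gt0 : (0 < s)%R.
Hypothesis s_lt1 : (s < 1)%R.
Variable phi : R -> set 'rV[R]_n -> 'rV[R]_n -> R.
Hypothesis phi_sol : forall (eps : R) E, (0 < eps)%R ->
  measurable_subset Omega E -> is_solution s Omega alpha beta eps E (phi eps E).
Local Notation c := (@c_ns R n s).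
Local Notation J_ := (J_eps s Omega phi).

Let c_gt0 : (0 < c)%R.
Proof. exact: c_ns_gt0. Qed.

Lemma phi_spec eps E : (0 < eps)%R -> measurable_subset Omega E ->
  [/\ in_W s Omega alpha beta (phi eps E) &
   forall v, in_W s Omega alpha beta v ->
   \int[mu]_(x in Omega) (phi eps E x * v x)%:E
    + (eps `^ s * c)%:E * energy_form mu Omega alpha beta k (phi eps E) v
   = \int[mu]_(x in Omega) (\1_E x * v x)%:E].
Proof. by move=> eps0 OE; have [] := phi_sol eps0 OE. Qed.

Lemma J_eps_identity eps E : (0 < eps)%R -> measurable_subset Omega E ->
  J_ eps E = (eps `^ s)^-1%:E *
    \int[mu]_(x in Omega) ((phi eps E x - \1_E x) ^+ 2)%:E
  + c%:E * energy (phi eps E).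
Proof.
move=> eps0 OE; have [Wphi weak] := phi_spec eps0 OE.
have [mphi _ phi2 phiE] := (in_WP _).1 Wphi.
have [mE EO] := OE.
rewrite /J_eps powRN (solution_energy_identity mOmega Omega_fin alpha_ge0
  beta_ge0 k_ge0 mphi mE phi2 phiE (weak _ Wphi)).
have es0 : (0 < eps `^ s)%R by exact: powR_gt0.
rewrite ge0_muleDr; last 2 first.
- by apply: integral_ge0 => x _; rewrite lee_fin sqr_ge0.
- rewrite mule_ge0//; first by rewrite lee_fin mulr_ge0// ltW.
  by rewrite adde_ge0// mule_ge0.
by rewrite [X in _ + X]muleA -EFinM mulrA mulVf ?mul1r// gt_eqF.
Qed.

Lemma J_eps_le_J_0 eps E : (0 < eps)%R -> measurable_subset Omega E ->
  J_ eps E <= J_0 s Omega alpha beta E.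
Proof.
move=> eps0 OE; have [Wphi weak] := phi_spec eps0 OE.
have [mphi _ phi2 phiE] := (in_WP _).1 Wphi.
have [mE EO] := OE; rewrite J_0E//.
(* An infinite limit energy makes the right side [+oo], as [c > 0]. Otherwise its finiteness is what
   places the competitor in the space of test functions. *)
have [->|Lfin] := eqVneq (limit_energy mu Omega alpha beta k E) +oo.
  by rewrite gt0_muley ?leey// lte_fin.
have es0 : (0 < eps `^ s)%R by exact: powR_gt0.
pose w := competitor mu Omega alpha beta k E.
have mw : measurable_fun setT w by exact: measurable_competitor.
have wE : energy w = limit_energy mu Omega alpha beta k E.
  exact: competitor_energy exterior_potential_lty.
have w01 x : (0 <= w x <= 1)%R by exact: competitor_itv.
have wfin : energy w < +oo by rewrite wE ltey.
have Ww : in_W s Omega alpha beta w.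
  apply/in_WP; split=> //.
  - apply: aeW => x Ox bx; rewrite /w /competitor memNset//.
    by rewrite bx !mul0r.
  - apply: (@le_lt_trans _ _ (\int[mu]_(x in Omega) 1)).
      apply: ge0_le_integral => //.
      + by move=> x _; rewrite lee_fin sqr_ge0.
      + apply/measurable_EFinP; apply: measurable_funTS.
        exact: measurable_funX.
      + by move=> x _; rewrite lee_fin; have := w01 x; nra.
    by rewrite integral_cst// mul1e.
have win x : Omega x -> w x = \1_E x by exact: competitor_in.
have h := solution_energy_le mOmega Omega_fin alpha_meas beta_meas alpha_ge0
  beta_ge0 mk k_ge0 mphi (mulr_ge0 (ltW es0) (ltW c_gt0)) mE phi2 phiE
  (weak _ Wphi) mw win wfin (weak _ Ww).
rewrite /J_eps powRN -wE; apply: (@le_trans _ _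
    ((eps `^ s)^-1%:E * ((eps `^ s * c)%:E * energy w))).
  by rewrite lee_wpmul2l// lee_fin invr_ge0 ltW.
by rewrite muleA -EFinM mulrA mulVf ?mul1r// gt_eqF.
Qed.

Lemma J_eps_lower (E : set 'rV[R]_n) (m : nat) : measurable_subset Omega E ->
  exists2 C : R, (0 <= C)%R & forall (eps : R) F, (0 < eps)%R ->
  measurable_subset Omega F ->
  c%:E * limit_energy mu Omega alpha beta (truncation k cube m) E <=
  J_ eps F + (eps `^ s * C ^+ 2)%:E * mu Omega
  + C%:E * \int[mu]_(x in Omega) (`|\1_F x - \1_E x : R|)%:E.
Proof.
move=> [mE EO].
have [M M0 ME] : exists2 M : R, (0 <= M)%R & mu Omega + mu (cube m) = M%:E.
  exists (fine (mu Omega + mu (cube m))); first by rewrite fine_ge0// adde_ge0.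
  rewrite fineK// ge0_fin_numE ?adde_ge0// lte_add_pinfty//.
  exact: lebesgue_box_fin.
(* This is [c] times the error constant of [limit_energy_le] for a kernel bounded by [m] on
   [cube m]; it depends neither on [eps] nor on [F]. *)
exists (c * (2 * m%:R * M))%R.
  by rewrite mulr_ge0 ?(ltW c_gt0)// mulr_ge0// mulr_ge0.
move=> eps F eps0 OF; set C := (c * _)%R.
have [Wphi _] := phi_spec eps0 OF; have [mF FO] := OF.
have [mphi phiae _ _] := (in_WP _).1 Wphi.
have C0 : (0 <= C)%R by rewrite /C mulr_ge0 ?(ltW c_gt0)// mulr_ge0// mulr_ge0.
have es0 : (0 < eps `^ s)%R by exact: powR_gt0.
have h1 := limit_energy_le mOmega Omega_fin alpha_meas beta_meas alpha_ge0
  beta_ge0 alpha_beta_gt0 mk k_ge0 kC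
  (measurable_truncation mk measurable_cube m) (truncation_ge0 cube k_ge0 m)
  (truncation_le cube k_ge0 m) (ler0n _ m) (measurable_cube m)
  (truncation_bound k cube m) mphi phiae mE EO.
(* The weight [eps ^ s] makes the quadratic term of the Young inequality coincide with the
   penalization in [J_eps_identity]. *)
have h2 := @integral_dist_le _ _ _ mu Omega (phi eps F) \1_F \1_E C (eps `^ s)
   mOmega (measurable_funTS mphi) _ _ C0 es0.
have c0 : 0 <= c%:E by rewrite lee_fin ltW.
apply: (le_trans (lee_wpmul2l c0 h1)).
rewrite ge0_muleDr; last 2 first.
- by rewrite adde_ge0// mule_ge0.
- apply: mule_ge0; last exact: adde_ge0.
  apply: mule_ge0; first by rewrite lee_fin mulr_ge0.
  by apply: integral_ge0 => x _; rewrite lee_fin.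
rewrite J_eps_identity// ME.
rewrite [X in _ + X](_ : _ =
    C%:E * \int[mu]_(x in Omega) (`|phi eps F x - \1_E x|)%:E); last first.
  by rewrite muleAC -EFinM muleA -EFinM.
rewrite -!addeA [X in _ <= X]addeCA leeD2l// addeA.
by apply: h2; exact: measurable_funTS.
Qed.

(** A real threshold [r] treats finite and infinite [J_0] alike. An intermediate [r'] fixes [m],
    hence [C], before [eps] is made small. *)
Lemma J_eps_liminf (E_ : R -> set 'rV[R]_n) E (r : R) :
  measurable_family Omega E_ -> measurable_subset Omega E ->
  cvg_L1 Omega E_ E -> r%:E < J_0 s Omega alpha beta E ->
  \forall eps \near (0 : R)^'+, r%:E <= J_ eps (E_ eps).
Proof.
move=> OE_ OE cvgE; have [mE EO] := OE; rewrite J_0E// => rJ.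
have [r' /andP[rr' r'J]] := ereal_between rJ.
have cvgL : c%:E * limit_energy mu Omega alpha beta (truncation k cube m) E
    @[m --> \oo] --> c%:E * limit_energy mu Omega alpha beta k E.
  apply: cvgeZl => //.
  exact: (cvg_limit_energy mOmega alpha_meas beta_meas alpha_ge0 beta_ge0 mk
    k_ge0 measurable_cube nondecreasing_cube bigcup_cube mE EO
    exterior_potential_lty).
have [m _ /(_ m (leqnn m)) /= r'L] := cvgL _ (open_ereal_gt' r'J).
have [C C0 JC] := J_eps_lower m OE.
(* Two errors share the gap [r' - r]: the Young remainder and the [L^1] distance. The summands [+ 1]
   in the denominators below guard against [C = 0] and against [Omega] of measure 0. *)
pose dl := ((r' - r) / 2)%R.
have dl0 : (0 < dl)%R by rewrite divr_gt0// subr_gt0 -lte_fin.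
have cE : \forall eps \near (0 : R)^'+,
    \int[mu]_(x in Omega) (`|\1_(E_ eps) x - \1_E x : R|)%:E < (dl / (C + 1))%:E.
  have d0 : 0 < (dl / (C + 1))%:E by rewrite lte_fin divr_gt0// ltr_wpDl.
  exact: (cvgE _ (open_ereal_lt' d0)).
have muO : mu Omega \is a fin_num by rewrite ge0_fin_numE.
have mu0 : (0 <= fine (mu Omega))%R by exact: fine_ge0.
have ce : \forall eps \near (0 : R)^'+,
    (`|0 - eps `^ s| <= dl / (C ^+ 2 * fine (mu Omega) + 1))%R.
  move: (powR_cvg0 s_gt0) => /cvgrPdist_le; apply.
  by rewrite divr_gt0// ltr_wpDl// mulr_ge0// sqr_ge0.
near=> eps.
have eps0 : (0 < eps)%R by near: eps; exact: nbhs_right_gt.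
have h1 : \int[mu]_(x in Omega) (`|\1_(E_ eps) x - \1_E x : R|)%:E <
  (dl / (C + 1))%:E by near: eps; exact: cE.
have h2 : (`|0 - eps `^ s| <= dl / (C ^+ 2 * fine (mu Omega) + 1))%R.
  by near: eps; exact: ce.
have := JC eps (E_ eps) eps0 (OE_ eps eps0).
move=> /(lt_le_trans r'L); rewrite -addeA => h3.
have e1 : (eps `^ s * C ^+ 2)%:E * mu Omega <= dl%:E.
  rewrite -(fineK muO) -EFinM lee_fin.
  move: h2; rewrite sub0r normrN ger0_norm ?powR_ge0//.
  rewrite ler_pdivlMr; last by rewrite ltr_wpDl// mulr_ge0// sqr_ge0.
  have := powR_ge0 eps s; lra.
have e2 : C%:E * \int[mu]_(x in Omega) (`|\1_(E_ eps) x - \1_E x : R|)%:E <= dl%:E.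
  apply: (@le_trans _ _ (C%:E * (dl / (C + 1))%:E)).
    by rewrite lee_wpmul2l// ltW.
  rewrite -EFinM lee_fin mulrA ler_pdivrMr; last by rewrite ltr_wpDl.
  lra.
have h4 : r'%:E < J_ eps (E_ eps) + (dl + dl)%:E.
  by apply: (lt_le_trans h3); rewrite leeD2l// EFinD leeD.
have -> : r = (r' - (dl + dl))%R by rewrite /dl; lra.
by rewrite EFinB leeBlDr// ltW.
Unshelve. all: by end_near.
Qed.

Lemma J_0_le_liminf (E_ : R -> set 'rV[R]_n) E :
  measurable_family Omega E_ -> measurable_subset Omega E ->
  cvg_L1 Omega E_ E ->
  J_0 s Omega alpha beta E <= liminf0 (fun eps => J_ eps (E_ eps)).
Proof.
move=> OE_ OE cvgE; rewrite leNgt; apply/negP => /ereal_between[r /andP[Lr rJ]].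
have rJe := J_eps_liminf OE_ OE cvgE rJ.
move: Lr; apply/negP; rewrite -leNgt /liminf0 limf_einfE.
(* The lower limit is a supremum of infima over the sets of the filter, and the set where the
   functional is at least [r] is one of them. *)
apply: ereal_sup_ge; exists (ereal_inf ((fun eps => J_ eps (E_ eps)) @`
    [set eps | r%:E <= J_ eps (E_ eps)])).
  by exists [set eps | r%:E <= J_ eps (E_ eps)].
by apply: le_ereal_inf_tmp => _ [eps + <-].
Qed.

(** A squeeze: the upper bound holds at every [eps > 0], and the lower one is the liminf estimate
    for the constant family. *)
Lemma cvg_J_eps E : measurable_subset Omega E ->
  J_ eps E @[eps --> (0 : R)^'+] --> J_0 s Omega alpha beta E.
Proof.
move=> OE.
have cE : cvg_L1 Omega (fun=> E) E.
  apply: cvg_near_cst; apply: nearW => eps.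
  by apply: integral0_eq => x _; rewrite subrr normr0.
have low (r : R) : r%:E < J_0 s Omega alpha beta E ->
    \forall eps \near (0 : R)^'+, r%:E <= J_ eps E.
  by apply: (J_eps_liminf (E_ := fun=> E)) => // eps _.
have up : \forall eps \near (0 : R)^'+, J_ eps E <= J_0 s Omega alpha beta E.
  by near=> eps; apply: J_eps_le_J_0 => //; near: eps; exact: nbhs_right_gt.
have J00 : 0 <= J_0 s Omega alpha beta E.
  rewrite J_0E// mule_ge0 ?lee_fin ?(ltW c_gt0)// adde_ge0//.
    by rewrite mule_ge0//; apply: integral_ge0 => p _; exact: jump_ge0.
  by apply: integral_ge0 => x Ox; exact: exterior_density_ge0.
(* [J00] excludes [-oo]; for [+oo] the lower thresholds alone give convergence. *)
move: low up J00; case: (J_0 s Omega alpha beta E) => [j||]// low up _; last first.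
  by apply/cvgeyPge => A; apply: low; rewrite ltry.
apply/fine_cvgP; split.
  have lj : \forall eps \near (0 : R)^'+, (j - 1)%:E <= J_ eps E.
    by apply: low; rewrite lte_fin; lra.
  near=> eps; have l : (j - 1)%:E <= J_ eps E by near: eps.
  have u : J_ eps E <= j%:E by near: eps.
  by rewrite fin_numE -ltNye -ltey (lt_le_trans _ l) ?ltNyr//= (le_lt_trans u)// ltry.
apply/cvgrPdist_le => e e0.
have lj : \forall eps \near (0 : R)^'+, (j - e)%:E <= J_ eps E.
  by apply: low; rewrite lte_fin; lra.
near=> eps; have l : (j - e)%:E <= J_ eps E by near: eps.
have u : J_ eps E <= j%:E by near: eps.
move: l u; rewrite /=; case: (J_ eps E) => [x||]//=; rewrite !lee_fin => l u.
by rewrite ger0_norm; lra.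
Unshelve. all: by end_near.
Qed.

(** The constant family is a recovery family, because the upper bound by [J_0] holds for each [eps]
    and not only in the limit. *)
Lemma Gamma_cvg_J_eps : Gamma_cvg Omega J_ (J_0 s Omega alpha beta).
Proof.
split=> [E_ E OE_ OE|E OE]; first exact: J_0_le_liminf.
exists (fun=> E); split.
- by move=> eps _.
- apply: cvg_near_cst; apply: nearW => eps.
  by apply: integral0_eq => x _; rewrite subrr normr0.
rewrite /limsup0 limf_esupE; apply: ge_ereal_inf.
exists (ereal_sup ((fun eps => J_ eps E) @` [set eps | (0 < eps)%R])).
  by exists [set eps | (0 < eps)%R] => //; exact: nbhs_right_gt.
by apply: ge_ereal_sup => _ [eps eps0 <-]; exact: J_eps_le_J_0.
Qed.

End fractional_energy.

Theorem theorem2p2 (R : realType) (n : nat) (n_gt0 : (0 < n)%N)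
    (s : R) (s_gt0 : 0 < s) (s_lt1 : s < 1)
    (Omega : set 'rV[R]_n) (Omega_open : open Omega)
    (Omega_bounded : bounded_set Omega)
    (Omega_perimeter : (P_s s Omega < +oo)%E)
    (alpha beta : 'rV[R]_n -> R)
    (alpha_meas : measurable_fun (~` Omega) alpha)
    (beta_meas : measurable_fun (~` Omega) beta)
    (alpha_ge0 : forall x, (~` Omega) x -> 0 <= alpha x)
    (beta_ge0 : forall x, (~` Omega) x -> 0 <= beta x)
    (alpha_beta_gt0 : forall x, (~` Omega) x -> 0 < alpha x + beta x)
    (phi : R -> set 'rV[R]_n -> 'rV[R]_n -> R)
    (phi_sol : forall (eps : R) (E : set 'rV[R]_n), 0 < eps ->
       measurable_subset Omega E ->
       is_solution s Omega alpha beta eps E (phi eps E)) :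
  [/\ forall E : set 'rV[R]_n, measurable_subset Omega E ->
        (P_sL s E Omega < +oo)%E ->
        J_eps s Omega phi eps E @[eps --> 0^'+] --> J_0 s Omega alpha beta E,
      forall (E_ : R -> set 'rV[R]_n) (E : set 'rV[R]_n),
        measurable_family Omega E_ -> measurable_subset Omega E ->
        cvg_L1 Omega E_ E ->
        (J_0 s Omega alpha beta E
           <= liminf0 (fun eps => J_eps s Omega phi eps (E_ eps)))%E
    & Gamma_cvg Omega (J_eps s Omega phi) (J_0 s Omega alpha beta)].
Proof.
split.
- by move=> E OE _; apply: cvg_J_eps.
- by move=> E_ E OE_ OE cvgE; apply: J_0_le_liminf.
- exact: Gamma_cvg_J_eps.
Qed.
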